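(* The constant $C=2sc\left(\frac{b-a}{c}+\lambda\right)$ defined in the context is transcendental.
   Context: Put $\beta=\pi/5$, $s=\sin\beta$, $c=\cos\beta$. Let $$\mathcal Q(t)=(7+30c)(t^4+1)+(94+300c)(t^3+t)+(134+428c)t^2-4sc\,(t^2-1)(t^2-4t+1),$$ and let $p$ be its unique zero in $[-\frac18,-\frac19]$. Let $$\mathcal N(t)=4ct^2s+4ct^2+24cts+4cs-4c+2t^2s-t^2+4ts+2s+1,$$ $$\mathcal D(t)=12ct^2s+12ct^2+24ct+20cs+12c+6t^2s+3t^2+10t+2s+3,$$ $$q=\frac{\mathcal N(p)}{\mathcal D(p)},\quad a=2\arctan p,\quad b=2\arctan q,\quad \lambda=\frac1s\left(\sin a+1+\frac{\sin(a+\beta)-\sin(b+\beta)}{2c}\right).$$ The number $C=1.282676025459\ldots$ is the escape constant (the length of a shortest escape path) of the golden gnomon, the isosceles triangle $\operatorname{conv}\{(-c,0),(c,0),(0,s)\}$. *)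

(* Defs.v *)
From HB Require Import structures.
From mathcomp Require Import all_boot all_order all_algebra.
From mathcomp Require Import all_classical all_reals all_analysis.
From mathcomp Require Import ring lra.

Set Implicit Arguments.
Unset Strict Implicit.
Unset Printing Implicit Defensive.

Import Order.TTheory GRing.Theory Num.Theory.
Import numFieldNormedType.Exports.
Local Open Scope classical_set_scope.
Local Open Scope ring_scope.

Definition transcendental (R : realType) (x : R) : Prop :=
  ~ algebraicOver (ratr : rat -> R) x.

Module GoldenGnomon.
Section EscapeConstant.
Variable R : realType.

Definition beta : R := pi / 5.
Definition s : R := sin beta.
Definition c : R := cos beta.

Definition Q (t : R) : R :=
  (7 + 30 * c) * (t ^+ 4 + 1) + (94 + 300 * c) * (t ^+ 3 + t)
  + (134 + 428 * c) * t ^+ 2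
  - 4 * s * c * (t ^+ 2 - 1) * (t ^+ 2 - 4 * t + 1).

Definition zeroQ (t : R) : Prop := - (1 / 8) <= t <= - (1 / 9) /\ Q t = 0.

(* Existence and uniqueness of the zero are proved in [zeroQ_unique] and
   [p_zeroQ] below, so the default value of [get] is never used. *)
Definition p : R := get [set t | zeroQ t].

Definition N (t : R) : R :=
  4 * c * t ^+ 2 * s + 4 * c * t ^+ 2 + 24 * c * t * s + 4 * c * s - 4 * c
  + 2 * t ^+ 2 * s - t ^+ 2 + 4 * t * s + 2 * s + 1.

Definition D (t : R) : R :=
  12 * c * t ^+ 2 * s + 12 * c * t ^+ 2 + 24 * c * t + 20 * c * s + 12 * c
  + 6 * t ^+ 2 * s + 3 * t ^+ 2 + 10 * t + 2 * s + 3.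

Definition q : R := N p / D p.
Definition a : R := 2 * atan p.
Definition b : R := 2 * atan q.

Definition lambda : R :=
  1 / s * (sin a + 1 + (sin (a + beta) - sin (b + beta)) / (2 * c)).

Definition C : R := 2 * s * c * ((b - a) / c + lambda).

Lemma s_gt0 : 0 < s.
Proof.
apply: sin_gt0_pi; rewrite /beta; have := pi_gt0 R; lra.
Qed.

Lemma c_gt0 : 0 < c.
Proof.
apply: cos_gt0_pihalf; rewrite /beta; have := pi_gt0 R; lra.
Qed.

Lemma c_quadratic : 4 * c ^+ 2 = 2 * c + 1.
Proof.
have c0 := c_gt0; have s0 := s_gt0.
have s2 : s ^+ 2 = 1 - c ^+ 2 by exact: sin2cos2.
have c2E : cos (beta + beta) = c * c - s * s by rewrite cosD.
have s2E : sin (beta + beta) = s * c + c * s by rewrite sinD.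
have c3E : cos (beta + beta + beta) = (c * c - s * s) * c - (s * c + c * s) * s.
  by rewrite cosD c2E s2E.
have c3N : cos (beta + beta + beta) = - cos (beta + beta).
  have -> : beta + beta + beta = - (beta + beta) + pi by rewrite /beta; field.
  by rewrite cosDpi cosN.
have h : (c + 1) * (4 * c ^+ 2 - (2 * c + 1)) = 0.
  move: c3N; rewrite c3E c2E -!expr2 => h.
  have -> : (c + 1) * (4 * c ^+ 2 - (2 * c + 1)) =
    (c ^+ 2 - (1 - c ^+ 2)) * c - (2 * c) * (1 - c ^+ 2)
    + (c ^+ 2 - (1 - c ^+ 2)) by ring.
  rewrite -s2.
  have -> : (2 * c) * s ^+ 2 = (s * c + c * s) * s by ring.
  by rewrite h addNr.
move/eqP: h; rewrite mulf_eq0 => /orP[/eqP|/eqP]; lra.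
Qed.

Lemma c_bounds : 809 / 1000 < c < 810 / 1000.
Proof.
have := c_gt0; have := c_quadratic; rewrite expr2 => h c0.
apply/andP; split; nra.
Qed.

Lemma s_bounds : 58 / 100 < s < 59 / 100.
Proof.
have s0 := s_gt0; have /andP[cl cu] := c_bounds.
have s2 : s ^+ 2 = 1 - c ^+ 2 by exact: sin2cos2.
move: s2; have := c_quadratic; rewrite !expr2 => h s2.
apply/andP; split; nra.
Qed.

Lemma sc_bounds : 46 / 100 < s * c < 48 / 100.
Proof.
have /andP[cl cu] := c_bounds; have /andP[sl su] := s_bounds.
apply/andP; split; nra.
Qed.

Lemma zeroQ_unique t u : zeroQ t -> zeroQ u -> t = u.
Proof.
move=> [/andP[tl tu] Qt] [/andP[ul uu] Qu].
have /andP[cl cu] := c_bounds; have /andP[el eu] := sc_bounds.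
pose A := t ^+ 2 + t * u + u ^+ 2; pose B := (t ^+ 2 + u ^+ 2) * (t + u).
have fac : Q t - Q u = (t - u) *
  ((7 + 30 * c) * B + (94 + 300 * c) * (A + 1) + (134 + 428 * c) * (t + u)
   - 4 * (s * c) * (B - 4 * A + 4)).
  by rewrite /Q /A /B; ring.
have hA : 0 <= A <= 3 / 64 by rewrite /A; apply/andP; split; nra.
have hS : 0 <= t ^+ 2 + u ^+ 2 <= 2 / 64 by apply/andP; split; nra.
have hB : - (1 / 128) <= B <= 0.
  by move: hS => /andP[]; rewrite /B => ? ?; apply/andP; split; nra.
move: hA hB fac; clearbody A B => /andP[A0 A1] /andP[B0 B1].
rewrite Qt Qu subrr => /esym/eqP; rewrite mulf_eq0 => /orP[|/eqP fac].
  by rewrite subr_eq0 => /eqP.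
exfalso; move: el eu fac; set e := s * c; clearbody e => el eu fac.
have h1 : - (1 / 2) <= (7 + 30 * c) * B by nra.
have h2 : 300 <= (94 + 300 * c) * (A + 1) by nra.
have h3 : - 125 <= (134 + 428 * c) * (t + u) by nra.
have h4 : 4 * e * (B - 4 * A + 4) <= 10 by nra.
lra.
Qed.

Lemma zeroQ_ex : exists t, zeroQ t.
Proof.
have /andP[cl cu] := c_bounds; have /andP[el eu] := sc_bounds.
have Ql : Q (- (1 / 8)) <= 0.
  rewrite /Q; move: el eu.
  have -> : 4 * s * c = 4 * (s * c) by ring.
  by set e := s * c; clearbody e => el eu; lra.
have Qr : 0 <= Q (- (1 / 9)).
  rewrite /Q; move: el eu.
  have -> : 4 * s * c = 4 * (s * c) by ring.
  by set e := s * c; clearbody e => el eu; lra.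
pose P : {poly R} :=
  (7 + 30 * c) *: ('X^4 + 1) + (94 + 300 * c) *: ('X^3 + 'X)
  + (134 + 428 * c) *: 'X^2
  - (4 * s * c) *: (('X^2 - 1) * ('X^2 - 4 *: 'X + 1)).
have PE t : P.[t] = Q t.
  rewrite /P /Q !(hornerD, hornerN, hornerZ, hornerM, hornerXn, hornerX, hornerC).
  ring.
have [||t tI /rootP Pt] := @poly_ivt R P (- (1 / 8)) (- (1 / 9)).
- lra.
- by rewrite !PE Ql Qr.
by exists t; split; rewrite -?PE.
Qed.

Lemma p_zeroQ : zeroQ p.
Proof. exact: (getPex zeroQ_ex). Qed.

Lemma D_gt0 : 0 < D p.
Proof.
have [/andP[pl pu] _] := p_zeroQ.
have /andP[cl cu] := c_bounds; have /andP[sl su] := s_bounds.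
have /andP[el eu] := sc_bounds.
have h1 : 0 <= p ^+ 2 by exact: sqr_ge0.
have h2 : - (1 / 8) * c <= c * p by nra.
have h3 : 0 <= c * p ^+ 2 by apply: mulr_ge0 => //; lra.
have h4 : 0 <= s * p ^+ 2 by apply: mulr_ge0 => //; lra.
have h5 : 0 <= s * c * p ^+ 2 by apply: mulr_ge0 => //; lra.
have -> : D p = 12 * (s * c * p ^+ 2) + 12 * (c * p ^+ 2) + 24 * (c * p)
  + 20 * (s * c) + 12 * c + 6 * (s * p ^+ 2) + 3 * p ^+ 2 + 10 * p + 2 * s + 3.
  by rewrite /D; ring.
lra.
Qed.

End EscapeConstant.
End GoldenGnomon.

(* Main.v *)
(** Since [lambda], [s] and [c] are algebraic, algebraicity of [C] would make
    [b - a] a positive real algebraic number, while [cos (b - a)] and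
    [sin (b - a)] are algebraic because [tan (a / 2)] and [tan (b / 2)] are.
    This contradicts the Hermite-Lindemann theorem for [x] and [e^(ix)].

    That theorem follows from type I Hermite-Pade approximation.  Put
    [L = m!]; starting from [E_0(t) = (e^(it/L) - 1)^m], let [E_(s+1)] be the
    solution of [E' = i (l/L) E + i E_s] vanishing at 0, with
    [l = s mod (m+1)].  Then [E_s(t) = \sum_(k <= m) A_(s,k)(it) e^(ikt/L)]
    with polynomials [A_(s,k)] whose exponential coefficients are integers of
    geometric size, [E_s(t)] is of order [C^s / (s+m)!], and the first [m+1]
    forms [E_s] with [s > (m+1)(N-1)] have determinant [k (it)^((m+1)N)],
    [k != 0], so that one of them is nonzero at [t = L x].  If [x] and [e^(ix)]
    are algebraic, a multiple [N! d^(N+m)] of this value is an eigenvalue of an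
    integer matrix of fixed size [D] with entries at most [N! C^N].  The lowest
    nonzero coefficient of its characteristic polynomial bounds it below by
    [(N! C^N)^-D], which is incompatible with the upper bound
    [N! C^N / ((m+1)N)!] as soon as [m+1 >= D+2]. *)

Require Import Defs.
From mathcomp Require Import all_boot all_order all_algebra perm.
From mathcomp Require Import all_classical all_reals all_analysis.
From mathcomp Require Import complex ring lra zify.

Set Implicit Arguments.
Unset Strict Implicit.
Unset Printing Implicit Defensive.

Import Order.TTheory GRing.Theory Num.Theory.
Import numFieldNormedType.Exports.
Import Normc.
Local Open Scope ring_scope.
Local Open Scope complex_scope.

Local Notation Re := complex.Re.
Local Notation Im := complex.Im.

(** * Complex-valued functions of a real variable *)

Section ComplexNorm.
Variable R : realType.
Implicit Types z w : R[i].

Lemma ReM z w : Re (z * w) = Re z * Re w - Im z * Im w.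
Proof. by case: z w => [? ?] [? ?]. Qed.

Lemma ImM z w : Im (z * w) = Re z * Im w + Im z * Re w.
Proof. by case: z w => [? ?] [? ?]. Qed.

Lemma ReD z w : Re (z + w) = Re z + Re w.
Proof. by case: z w => [? ?] [? ?]. Qed.

Lemma ImD z w : Im (z + w) = Im z + Im w.
Proof. by case: z w => [? ?] [? ?]. Qed.

Lemma normc_ge0 z : 0 <= normc z.
Proof. by case: z => a b /=; rewrite sqrtr_ge0. Qed.

Lemma normcX z n : normc (z ^+ n) = normc z ^+ n.
Proof.
elim: n => [|n IHn]; first by rewrite !expr0 normc1.
by rewrite !exprS normcM IHn.
Qed.

Lemma normc_real (x : R) : normc x%:C = `|x|.
Proof. by rewrite /= expr0n addr0 sqrtr_sqr. Qed.

Lemma normc_int (n : int) : normc n%:~R = `|n|%:~R :> R.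
Proof. by rewrite -(rmorph_int (real_complex R)) normc_real intr_norm. Qed.

Lemma normc_nat n : normc n%:R = n%:R :> R.
Proof. by rewrite -(rmorph_nat (real_complex R)) normc_real normr_nat. Qed.

Lemma normc_sum (I : Type) (r : seq I) (P : pred I) (f : I -> R[i]) :
  normc (\sum_(i <- r | P i) f i) <= \sum_(i <- r | P i) normc (f i).
Proof.
apply: (big_ind2 (fun z x => normc z <= x)) => //; first by rewrite normc0.
by move=> z x w y zx wy; apply: le_trans (le_normcD _ _) (lerD zx wy).
Qed.

Lemma normc_eq0 z : (normc z == 0) = (z == 0).
Proof.
by apply/eqP/eqP => [/eq0_normc //|->]; rewrite normc0.
Qed.

Lemma Re_le_normc z : `|Re z| <= normc z.
Proof.
by case: z => a b /=; rewrite -sqrtr_sqr ler_wsqrtr // lerDl sqr_ge0.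
Qed.

Lemma Im_le_normc z : `|Im z| <= normc z.
Proof.
by case: z => a b /=; rewrite -sqrtr_sqr ler_wsqrtr // lerDr sqr_ge0.
Qed.

Lemma normc_i : normc ('i%C : R[i]) = 1.
Proof. by rewrite /= expr0n add0r expr1n sqrtr1. Qed.

Lemma normc_le_ReIm z : normc z <= `|Re z| + `|Im z|.
Proof.
rewrite [z in X in X <= _]complexE; apply: le_trans (le_normcD _ _) _.
by rewrite normcM normc_i mul1r !normc_real.
Qed.

End ComplexNorm.

(** * Derivatives of complex-valued functions and bounds by integration *)

Section ComplexDerivative.
Variable R : realType.
Implicit Types (f g : R -> R[i]) (t : R).

(** Differentiation is split into real and imaginary parts, so that the real calculus applies to
    each of them. *)
Definition is_cderive f t (d : R[i]) : Prop :=
  is_derive t 1 (fun x => Re (f x)) (Re d) /\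
  is_derive t 1 (fun x => Im (f x)) (Im d).

Lemma is_cderive_cst (z : R[i]) t : is_cderive (fun=> z) t 0.
Proof. by split; exact: is_derive_cst. Qed.

Lemma is_cderiveD f g t df dg :
  is_cderive f t df -> is_cderive g t dg ->
  is_cderive (fun x => f x + g x) t (df + dg).
Proof.
move=> [f1 f2] [g1 g2]; split.
  under eq_fun do rewrite ReD.
  by rewrite ReD; exact: is_deriveD.
under eq_fun do rewrite ImD.
by rewrite ImD; exact: is_deriveD.
Qed.

Lemma is_cderiveM f g t df dg :
  is_cderive f t df -> is_cderive g t dg ->
  is_cderive (fun x => f x * g x) t (df * g t + f t * dg).
Proof.
move=> [f1 f2] [g1 g2]; split.
  under eq_fun do rewrite ReM.
  rewrite ReD !ReM; apply: is_derive_eq.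
  by rewrite /GRing.scale /=; ring.
under eq_fun do rewrite ImM.
rewrite ImD !ImM; apply: is_derive_eq.
by rewrite /GRing.scale /=; ring.
Qed.

Lemma is_cderive_sum (I : Type) (r : seq I) (f : I -> R -> R[i]) t d :
  (forall i, is_cderive (f i) t (d i)) ->
  is_cderive (fun x => \sum_(i <- r) f i x) t (\sum_(i <- r) d i).
Proof.
move=> fd; elim: r => [|i r IHr].
  under eq_fun do rewrite big_nil.
  by rewrite big_nil; exact: is_cderive_cst.
under eq_fun do rewrite big_cons.
by rewrite big_cons; exact: is_cderiveD.
Qed.

Lemma is_cderive_horner (p : {poly R[i]}) t :
  is_cderive (fun x => p.['i%C * x%:C]) t ('i%C * p^`().['i%C * t%:C]).
Proof.
elim/poly_ind: p => [|p c IHp].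
  under eq_fun do rewrite horner0.
  by rewrite deriv0 horner0 mulr0; exact: is_cderive_cst.
under eq_fun do rewrite hornerMXaddC.
rewrite derivD derivM derivX derivC addr0 mulr1 hornerD hornerMX.
have dI : is_cderive (fun x : R => 'i%C * x%:C) t 'i%C.
  split.
    under eq_fun do rewrite ReM /= mul0r mulr0 subr0.
    by exact: is_derive_cst.
  under eq_fun do rewrite ImM /= mul0r mul1r add0r.
  exact: is_derive_id.
have := is_cderiveD (is_cderiveM IHp dI) (is_cderive_cst c t).
congr is_cderive; ring.
Qed.

Definition cis (x : R) : R[i] := cos x +i* sin x.

Lemma cisD x y : cis (x + y) = cis x * cis y.
Proof.
apply/eqP; rewrite eq_complex /= cosD sinD.
by apply/andP; split; apply/eqP; ring.
Qed.

Lemma cis0 : cis 0 = 1.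
Proof. by rewrite /cis cos0 sin0. Qed.

Lemma cisMn x n : cis (x *+ n) = cis x ^+ n.
Proof.
elim: n => [|n IHn]; first by rewrite mulr0n expr0 cis0.
by rewrite mulrS exprS cisD IHn.
Qed.

Lemma normc_cis x : normc (cis x) = 1.
Proof. by rewrite /= cos2Dsin2 sqrtr1. Qed.

Lemma is_cderive_cis (k t : R) :
  is_cderive (fun x => cis (k * x)) t ('i%C * k%:C * cis (k * t)).
Proof.
have dk : is_derive t 1 (fun x => k * x) k.
  by apply: is_derive_eq; rewrite /GRing.scale /= mulr1.
split.
  have -> : Re ('i%C * k%:C * cis (k * t)) = - sin (k * t) * k.
    by rewrite !ReM !ImM /=; ring.
  exact: (is_derive1_comp (is_derive_cos (k * t)) dk).
have -> : Im ('i%C * k%:C * cis (k * t)) = cos (k * t) * k.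
  by rewrite ImM !ReM !ImM /=; ring.
exact: (is_derive1_comp (is_derive_sin (k * t)) dk).
Qed.

(** The difference [h] of the two sides vanishes at 0 and has a nonnegative derivative to the right
    of 0. *)
Lemma le_integral_real (g dg : R -> R) (K : R) n :
  (forall t, is_derive t 1 g (dg t)) -> g 0 = 0 ->
  (forall t, 0 <= t -> dg t <= K * t ^+ n / n`!%:R) ->
  forall t, 0 <= t -> g t <= K * t ^+ n.+1 / n.+1`!%:R.
Proof.
move=> gd g0 dgK t t0.
pose h x := K * x ^+ n.+1 / n.+1`!%:R - g x.
have hd (x : R) : is_derive x 1 h (K * x ^+ n / n`!%:R - dg x).
  have -> : h = (K / n.+1`!%:R) \*: ((@id R) ^+ n.+1) - g.
    by apply/funext => y; rewrite /h exprfctE mulrAC.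
  have := is_deriveB (is_deriveZ (K / n.+1`!%:R) (is_deriveX n.+1
    (is_derive_id x 1))) (gd x).
  move/is_derive_eq; apply; rewrite /GRing.scale /= factS natrM.
  field.
  by rewrite nat1r !pnatr_eq0 -lt0n fact_gt0.
have hder (x : R) : derivable h x 1 by have [] := hd x.
have hder1 x : derive1 h x = K * x ^+ n / n`!%:R - dg x.
  by rewrite derive1E; have [_ ->] := hd x.
have : h 0 <= h t.
  apply: (@ger0_derive1_ndecr _ h 0 t) => //.
  - by move=> x; rewrite in_itv /= => /andP[/ltW x0 _]; rewrite hder1 subr_ge0 dgK.
  - by apply: derivable_within_continuous => x _; exact: hder.
by rewrite /h expr0n /= mulr0 mul0r g0 subrr subr_ge0.
Qed.

(** Real and imaginary parts are integrated separately, which costs the factor 2; after [s]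
    iterations this is only a factor 2^s. *)
Lemma normc_le_integral f df (K : R) n :
  (forall t, is_cderive f t (df t)) -> f 0 = 0 ->
  (forall t, 0 <= t -> normc (df t) <= K * t ^+ n / n`!%:R) ->
  forall t, 0 <= t -> normc (f t) <= 2 * K * t ^+ n.+1 / n.+1`!%:R.
Proof.
move=> fd f0 dfK t t0.
have aux (g dg : R -> R) : (forall t, is_derive t 1 g (dg t)) -> g 0 = 0 ->
    (forall t, 0 <= t -> `|dg t| <= K * t ^+ n / n`!%:R) ->
    `|g t| <= K * t ^+ n.+1 / n.+1`!%:R.
  move=> gd g0 dgK; rewrite ler_norml; apply/andP; split; last first.
    apply: le_integral_real t0 => // x x0.
    exact: le_trans (ler_norm _) (dgK _ x0).
  have gd' (x : R) : is_derive x 1 (fun x => - g x) (- dg x)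
    by exact: (is_deriveN (gd x)).
  rewrite lerNl; apply: (le_integral_real gd') t0; first by rewrite g0 oppr0.
  by move=> x x0; apply: le_trans (dgK _ x0); rewrite -normrN ler_norm.
apply: le_trans (normc_le_ReIm _) _.
have -> : 2 * K * t ^+ n.+1 / n.+1`!%:R =
  K * t ^+ n.+1 / n.+1`!%:R + K * t ^+ n.+1 / n.+1`!%:R by ring.
apply: lerD.
  apply: (aux (fun x => Re (f x)) (fun x => Re (df x))); rewrite ?f0 //.
    by move=> x; have [] := fd x.
  by move=> x x0; apply: le_trans (Re_le_normc _) (dfK _ x0).
apply: (aux (fun x => Im (f x)) (fun x => Im (df x))); rewrite ?f0 //.
  by move=> x; have [] := fd x.
by move=> x x0; apply: le_trans (Im_le_normc _) (dfK _ x0).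
Qed.

End ComplexDerivative.

(** * Eigenvalues of integer matrices *)

Section Liouville.
Variable R : realType.

(** Coefficientwise majorants are compatible with sums and products, hence with the expansion of a
    determinant. *)
Definition dominated (p : {poly int}) (P : {poly R}) : Prop :=
  forall i, `|p`_i|%:~R <= P`_i.

Lemma dominatedM p q P Q :
  dominated p P -> dominated q Q -> dominated (p * q) (P * Q).
Proof.
move=> pP qQ i; rewrite !coefM.
apply: le_trans (_ : (\sum_(j < i.+1) `|p`_j * q`_(i - j)|)%:~R <= _).
  by rewrite ler_int ler_norm_sum.
rewrite rmorph_sum /=; apply: ler_sum => j _.
rewrite normrM intrM ler_pM ?ler0z //.
Qed.

Lemma dominated_prod (I : Type) (r : seq I) (p : I -> {poly int}) P :
  (forall i, dominated (p i) (P i)) ->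
  dominated (\prod_(i <- r) p i) (\prod_(i <- r) P i).
Proof.
move=> pP; elim: r => [|i r IHr].
  by rewrite !big_nil => -[|j]; rewrite !coef1.
by rewrite !big_cons; exact: dominatedM.
Qed.

Lemma dominated_sum (I : finType) (p : I -> {poly int}) P :
  (forall i, dominated (p i) (P i)) ->
  dominated (\sum_i p i) (\sum_i P i).
Proof.
move=> pP j; rewrite !coef_sum.
apply: le_trans (_ : (\sum_i `|(p i)`_j|)%:~R <= _).
  by rewrite ler_int ler_norm_sum.
by rewrite rmorph_sum /=; apply: ler_sum => i _; exact: pP.
Qed.

(** Every entry of the characteristic matrix, diagonal or not, has the same linear majorant, so the
    n! products of the Leibniz expansion share one majorant as well. *)
Lemma dominated_char_poly n (M : 'M[int]_n) (H : R) : 0 <= H ->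
  (forall i j, `|M i j|%:~R <= H) ->
  dominated (char_poly M) (((H + 1)%:P * (1 + 'X)) ^+ n *+ n`!).
Proof.
move=> H0 MH; rewrite /char_poly /determinant.
have -> : ((H + 1)%:P * (1 + 'X)) ^+ n *+ n`! =
    \sum_(s : 'S_n) \prod_(i < n) ((H + 1)%:P * (1 + 'X)) :> {poly R}.
  by rewrite sumr_const prodr_const card_ord card_Sn.
apply: dominated_sum => s; rewrite mulr_sign.
have dom : dominated (\prod_(i < n) char_poly_mx M i (s i))
    (\prod_(i < n) ((H + 1)%:P * (1 + 'X))).
  apply: dominated_prod => i k; rewrite coefCM !mxE !coefD coefN coefC coef1.
  rewrite coefMn !coefX.
  case: k => [|[|k]] /=; rewrite ?mul0rn ?sub0r ?normrN ?addr0 ?add0r ?mulr1.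
  - by apply: le_trans (MH _ _) _; rewrite lerDl.
  - by case: (_ == _); rewrite ?normr1 ?normr0; rewrite ?lerDr // addr_ge0.
  - by rewrite mulr0.
by case: (odd_perm s) => //= k; rewrite coefN normrN.
Qed.

(** Since [x] is nonzero, factors X can be divided out until the constant term c is nonzero. Writing
    the polynomial as p X + c, one has 1 <= |c| = |x| |p(x)|. If |x| <= 1, then |p(x)| is at most
    the sum of the absolute values of the coefficients of p; if |x| > 1, the bound 1 <= |c| <= [B]
    suffices. *)
Lemma int_root_lower_bound (x : R[i]) (p : {poly int}) n (B : R) :
  x != 0 -> p != 0 -> root (map_poly intr p) x -> (size p <= n)%N ->
  \sum_(i < n) `|p`_i|%:~R <= B -> 1 <= normc x * B.
Proof.
move=> x0; elim/poly_ind: p n B => [|p c IHp] n B; first by rewrite eqxx.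
move=> pc0 rt szn SB.
case: n szn SB => [|n]; first by rewrite leqn0 size_poly_eq0 (negPf pc0).
rewrite size_MXaddC; case: ifP => [/andP[/eqP p0 /eqP c0]|_ szn].
  by rewrite p0 c0 mul0r add0r eqxx in pc0.
rewrite big_ord_recl /= coefD coefMX coefC /= add0r.
under eq_bigr do rewrite /bump /= add1n coefD coefMX coefC /= addr0.
move=> SB; move: rt.
rewrite rmorphD rmorphM /= map_polyX map_polyC rootE hornerMXaddC.
have [c0|c0] := eqVneq c 0.
  rewrite c0 addr0 mulf_eq0 (negPf x0) orbF => rt.
  apply: (IHp n) => //.
    by apply: contra pc0 => /eqP->; rewrite c0 mul0r add0r.
  by apply: le_trans SB; rewrite lerDr ler0z.
rewrite addr_eq0 => /eqP E.
have ci : 1 <= `|c|%:~R :> R by rewrite ler1z -gtz0_ge1 normr_gt0.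
have c1 : 1 <= normc x * normc (map_poly intr p).[x].
  by rewrite mulrC -normcM E normcN normc_int; exact: ci.
have S0 : 0 <= \sum_(i < n) `|p`_i|%:~R :> R.
  by apply: sumr_ge0 => i _; rewrite ler0z.
have B1 : 1 <= B.
  by apply: le_trans ci (le_trans _ SB); rewrite lerDl.
have [x1|x1] := lerP (normc x) 1; last by rewrite mulr_ege1 // ltW.
apply: le_trans c1 _; rewrite ler_wpM2l ?normc_ge0 //.
rewrite (@horner_coef_wide _ n) ?size_map_inj_poly //; last exact: intr_inj.
apply: le_trans (normc_sum _ _ _) _; apply: le_trans SB.
rewrite -[X in X <= _]add0r lerD ?ler0z //; apply: ler_sum => i _.
rewrite coef_map /= normcM normc_int normcX ler_piMr ?ler0z //.
by rewrite exprn_ile1 ?normc_ge0.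
Qed.

(** * Arithmetic of eigenvalues with a fixed eigenvector *)

Section IntEigen.
Variables (n : nat) (v : 'rV[R[i]]_n).

(** With the row [v] fixed, sums and products of numbers are realised by sums and products of
    matrices of the same size, while [H] tracks the size of the entries. *)
Definition int_eigen (H : R) (x : R[i]) : Prop :=
  exists2 M : 'M[int]_n, (forall i j, `|M i j|%:~R <= H) &
    v *m map_mx intr M = x *: v.

Lemma int_eigen_le H K x : H <= K -> int_eigen H x -> int_eigen K x.
Proof. by move=> HK [M MH vM]; exists M => // i j; exact: le_trans HK. Qed.

Lemma int_eigenD H K x y :
  int_eigen H x -> int_eigen K y -> int_eigen (H + K) (x + y).
Proof.
move=> [M MH vM] [N NK vN]; exists (M + N) => [i j|]; last first.
  by rewrite map_mxD mulmxDr vM vN scalerDl.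
rewrite mxE; apply: le_trans (lerD (MH i j) (NK i j)).
by rewrite -intrD ler_int ler_normD.
Qed.

Lemma int_eigenM H K x y :
  int_eigen H x -> int_eigen K y -> int_eigen (n%:R * (H * K)) (x * y).
Proof.
move=> [M MH vM] [N NK vN]; exists (M *m N) => [i j|]; last first.
  by rewrite map_mxM mulmxA vM -scalemxAl vN scalerA.
rewrite mxE.
apply: le_trans (_ : (\sum_k `|M i k * N k j|)%:~R <= _).
  by rewrite ler_int ler_norm_sum.
rewrite rmorph_sum /= -[n in X in _ <= X]card_ord -sumr_const mulr_suml.
by apply: ler_sum => k _; rewrite mul1r normrM intrM ler_pM ?ler0z.
Qed.

Lemma int_eigen_int (k : int) : int_eigen `|k|%:~R k%:~R.
Proof.
exists k%:M => [i j|]; last by rewrite map_scalar_mx mul_mx_scalar.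
by rewrite mxE; case: (_ == _); rewrite ?mulr1n // mulr0n normr0 ler0z.
Qed.

Lemma int_eigen_sum (I : Type) (r : seq I) (H : I -> R) (x : I -> R[i]) :
  (forall i, int_eigen (H i) (x i)) ->
  int_eigen (\sum_(i <- r) H i) (\sum_(i <- r) x i).
Proof.
move=> Hx; elim: r => [|i r IHr].
  by rewrite !big_nil; apply: (int_eigen_int 0).
by rewrite !big_cons; exact: int_eigenD.
Qed.

Lemma int_eigenX H x k : 0 <= H ->
  int_eigen H x -> int_eigen ((n.+1%:R * H) ^+ k) (x ^+ k).
Proof.
move=> H0 Hx; elim: k => [|k IHk].
  by rewrite !expr0; apply: (int_eigen_int 1).
rewrite !exprS; apply: int_eigen_le (int_eigenM Hx IHk).
rewrite mulrA ler_wpM2r ?exprn_ge0 ?mulr_ge0 //.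
by rewrite ler_wpM2r // ler_nat.
Qed.

(** [x] is a root of the characteristic polynomial, whose coefficients have absolute values summing
    to at most the value at 1 of the majorant in [dominated_char_poly]. *)
Lemma int_eigen_lower_bound H x : v != 0 -> x != 0 -> 0 <= H ->
  int_eigen H x -> 1 <= normc x * (n`!%:R * (2 * (H + 1)) ^+ n).
Proof.
move=> v0 x0 H0 [M MH vM].
have rt : root (map_poly intr (char_poly M)) x.
  rewrite map_char_poly -eigenvalue_root_char.
  by apply/eigenvalueP; exists v.
have p0 : char_poly M != 0 by rewrite monic_neq0 // char_poly_monic.
have dom := dominated_char_poly H0 MH.
set P := _ *+ _ in dom.
pose N := maxn (size (char_poly M)) (size P).
have -> : n`!%:R * (2 * (H + 1)) ^+ n = \sum_(i < N) P`_i.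
  have -> : \sum_(i < N) P`_i = P.[1].
    rewrite (@horner_coef_wide _ N) ?leq_maxr //.
    by apply: eq_bigr => i _; rewrite expr1n mulr1.
  rewrite /P hornerMn horner_exp hornerM hornerD hornerX !hornerC.
  by rewrite -[RHS]mulr_natl [2 * _]mulrC.
apply: (int_root_lower_bound x0 p0 rt (leq_maxl _ (size P))).
by apply: ler_sum => i _; exact: dom.
Qed.

End IntEigen.
End Liouville.

(** * Common eigenvectors for two algebraic numbers *)

Section CommonEigenvector.
Variable R : realType.

Lemma int_eigen_exists n (v : 'rV[R[i]]_n) (M : 'M[int]_n) x :
  v *m map_mx intr M = x *: v -> exists2 H, 0 <= H & int_eigen v H x.
Proof.
move=> vM; exists (\sum_i \sum_j `|M i j|%:~R).
  by apply: sumr_ge0 => i _; apply: sumr_ge0 => j _; rewrite ler0z.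
exists M => // i j; rewrite (bigD1 i) //= (bigD1 j) //= -addrA lerDl addr_ge0 //.
  by apply: sumr_ge0 => k _; rewrite ler0z.
by apply: sumr_ge0 => k _; apply: sumr_ge0 => l _; rewrite ler0z.
Qed.

Lemma algebraic_int_poly (x : R[i]) : algebraicOver ratr x ->
  exists2 q : {poly int}, q != 0 & root (map_poly intr q) x.
Proof.
case=> p p0 rp; have [q [a a0 pE]] := rat_poly_scale p.
exists q; first by apply: contra p0 => /eqP q0; rewrite pE q0 rmorph0 scaler0.
move: rp; rewrite pE linearZ /= rootE hornerZ mulf_eq0.
rewrite fmorph_eq0 invr_eq0 intr_eq0 (negPf a0) /= -map_poly_comp.
by under eq_map_poly do rewrite /= ratr_int.
Qed.

(* The companion matrix, multiplied by the leading coefficient to clear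
   denominators, acts on the powers of [x]. *)
Lemma algebraic_eigen (x : R[i]) : algebraicOver ratr x ->
  exists n (v : 'rV[R[i]]_n) (d : int) (M : 'M[int]_n),
    [/\ v != 0, d != 0 & v *m map_mx intr M = (d%:~R * x) *: v].
Proof.
move=> /algebraic_int_poly[q q0 rq].
pose n := (size q).-1.
have n0 : (0 < n)%N.
  rewrite /n -subn1 subn_gt0 ltn_neqAle lt0n size_poly_eq0 q0 andbT eq_sym.
  apply/negP => /eqP/eqP/size_poly1P[c c0 qE]; move: rq.
  by rewrite qE map_polyC rootC intr_eq0 (negPf c0).
exists n, (\row_j x ^+ j), (lead_coef q), (\matrix_(i, j)
  if j.+1 == n then - q`_i else lead_coef q *+ (i == j.+1 :> nat)).
split; last 2 first.
- by rewrite lead_coef_eq0.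
- apply/rowP => j; rewrite !mxE.
  have szq : size (map_poly (intr : int -> R[i]) q) = n.+1.
    by rewrite size_map_inj_poly ?prednK ?size_poly_gt0 //; exact: intr_inj.
  (* In the last column, q(x) = 0 expresses the leading term through the lower powers of [x]. *)
  have [jn|jn] := eqVneq j.+1 n.
    move/rootP: rq; rewrite horner_coef szq big_ord_recr /= coef_map /=.
    rewrite -[n in q`_n]/n => /eqP; rewrite addrC addr_eq0 => /eqP E.
    rewrite -mulrA -exprS jn /lead_coef E -sumrN; apply: eq_bigr => i _.
    by rewrite !mxE jn eqxx coef_map rmorphN mulrN mulrC.
  have jn' : (j.+1 < n)%N by rewrite ltn_neqAle jn ltn_ord.
  rewrite (bigD1 (Ordinal jn')) //= big1 => [|i ij].
    by rewrite !mxE (negPf jn) eqxx addr0 exprS mulrC mulrA.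
  rewrite !mxE (negPf jn); case: eqP => [ij'|]; last by rewrite mulr0.
  by case/eqP: ij; apply: val_inj.
apply/eqP => /rowP/(_ (Ordinal n0)); rewrite !mxE expr0 => /eqP.
by rewrite oner_eq0.
Qed.

(** The rank-one matrix [v1^T *m v2], flattened to a row, is an eigenvector both of left
    multiplication by [M1^T] and of right multiplication by [M2]. Scaling these maps by [d2] and
    [d1] gives both eigenvalues the common factor [d1 * d2]. *)
Lemma algebraic_common_eigen (x y : R[i]) :
  algebraicOver ratr x -> algebraicOver ratr y ->
  exists n (v : 'rV[R[i]]_n) (d : int) (H : R),
    [/\ v != 0, d != 0, 0 <= H, int_eigen v H (d%:~R * x) &
        int_eigen v H (d%:~R * y)].
Proof.
move=> /algebraic_eigen[n1 [v1 [d1 [M1 [v10 d10 vM1]]]]].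
move=> /algebraic_eigen[n2 [v2 [d2 [M2 [v20 d20 vM2]]]]].
pose V := v1^T *m v2.
have V0 : mxvec V != 0.
  have [i v1i] : exists i, v1 0 i != 0 by apply/rV0Pn.
  have [j v2j] : exists j, v2 0 j != 0 by apply/rV0Pn.
  apply/eqP => /rowP/(_ (mxvec_index i j)); rewrite mxvecE !mxE big_ord1 mxE.
  by apply/eqP; rewrite mulf_neq0.
have E1 : mxvec V *m map_mx intr (d2 *: lin_mx (mulmx M1^T)) =
    ((d1 * d2)%:~R * x) *: mxvec V.
  rewrite map_mxZ (@map_lin_mx _ _ _ _ _ _ _ _ (mulmx (map_mx intr M1)^T)).
    rewrite -scalemxAr mul_vec_lin /= mulmxA -trmx_mul vM1 linearZ /= -scalemxAl.
    by rewrite linearZ scalerA rmorphM mulrA [_ * d2%:~R]mulrC.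
  by move=> A; rewrite map_mxM map_trmx.
have E2 : mxvec V *m map_mx intr (d1 *: lin_mx (mulmxr M2)) =
    ((d1 * d2)%:~R * y) *: mxvec V.
  rewrite map_mxZ (@map_lin_mx _ _ _ _ _ _ _ _ (mulmxr (map_mx intr M2))).
    rewrite -scalemxAr mul_vec_lin /= -mulmxA vM2 -scalemxAr.
    by rewrite linearZ scalerA rmorphM mulrA.
  by move=> A; rewrite map_mxM.
have [H1 H10 e1] := int_eigen_exists E1.
have [H2 H20 e2] := int_eigen_exists E2.
exists _, (mxvec V), (d1 * d2), (H1 + H2); split=> //.
- by rewrite mulf_neq0.
- exact: addr_ge0.
- by apply: int_eigen_le e1; rewrite lerDl.
- by apply: int_eigen_le e2; rewrite lerDr.
Qed.

End CommonEigenvector.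

(** * Exponential polynomials *)

Section ExponentialPolynomials.
Variables (F : numFieldType) (K : realFieldType).
Implicit Types (A B : {poly F}) (e u : F).

(** For u = 1/e this inverts B -> B' + u B by a Neumann series in the derivative, finite because [A]
    is a polynomial. Equivalently, B(z) e^(uz) is a primitive of A(z) e^(uz). *)
Definition twisted_primitive e A : {poly F} :=
  \sum_(i < size A) ((-1) ^+ i * e ^+ i.+1) *: A^`(i).

Lemma twisted_primitiveE e u A : e * u = 1 ->
  (twisted_primitive e A)^`() + u *: twisted_primitive e A = A.
Proof.
(* The sum B' + u B telescopes into differences of [T], which vanishes at [size A] and equals [- A]
   at 0. *)
move=> eu; pose T i := ((-1) ^+ i.+1 * e ^+ i) *: A^`(i).
rewrite /twisted_primitive raddf_sum scaler_sumr -big_split /=.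
rewrite (eq_bigr (fun i : 'I_(size A) => T i.+1 - T i)) => [|i _]; last first.
  rewrite /T derivZ scalerA -derivnS -scaleNr; congr (_ *: _ + _ *: _).
    by rewrite !exprS; ring.
  have -> : u * ((-1) ^+ i * e ^+ i.+1) = (-1) ^+ i * e ^+ i * (e * u).
    by rewrite exprS; ring.
  by rewrite eu exprS; ring.
rewrite -(big_mkord xpredT (fun i => T i.+1 - T i)) telescope_sumr //.
rewrite /T derivn_poly0 // scaler0 sub0r expr0 mulr1 expr1 scaleN1r opprK.
by rewrite derivn0.
Qed.

Lemma size_twisted_primitive e u A : e * u = 1 ->
  size (twisted_primitive e A) = size A.
Proof.
move=> eu; have := twisted_primitiveE A eu.
set B := twisted_primitive e A => <-.
have u0 : u != 0.
  by apply/eqP => u0; move/eqP: eu; rewrite u0 mulr0 eq_sym oner_eq0.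
have [->|B0] := eqVneq B 0; first by rewrite deriv0 scaler0 addr0.
by rewrite addrC size_polyDl size_scale // lt_size_deriv.
Qed.

(** At [i = 0] the division by zero yields 0, so this primitive vanishes at 0. *)
Definition primitive A : {poly F} :=
  \poly_(i < (size A).+1) (A`_i.-1 / i%:R).

Lemma deriv_primitive A : (primitive A)^`() = A.
Proof.
apply/polyP => i; rewrite coef_deriv coef_poly ltnS /=.
case: ltnP => [_|ge]; last by rewrite mul0rn nth_default.
by rewrite -[LHS]mulr_natr mulfVK // pnatr_eq0.
Qed.

Lemma size_primitive A : A != 0 -> size (primitive A) = (size A).+1.
Proof.
move=> A0; apply: size_poly_eq.
by rewrite mulf_neq0 ?invr_eq0 ?pnatr_eq0 ?size_poly_eq0 // lead_coef_eq0.
Qed.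

(** This is the j-th derivative at 0. On these numbers derivation and [primitive] act as shifts, so
    no denominators appear. *)
Definition egf_coef A j : F := A`_j * j`!%:R.

Lemma egf_coefE A j : A`_j = egf_coef A j / j`!%:R.
Proof. by rewrite mulfK // pnatr_eq0 -lt0n fact_gt0. Qed.

Lemma egf_coef_derivn A i j : egf_coef A^`(i) j = egf_coef A (i + j).
Proof.
rewrite /egf_coef coef_derivn -[_ *+ _]mulr_natr -mulrA -natrM; congr (_ * _%:R).
by have := ffact_fact (leq_addr j i); rewrite addKn.
Qed.

Lemma egf_coef_primitive A j : egf_coef (primitive A) j.+1 = egf_coef A j.
Proof.
rewrite /egf_coef coef_poly ltnS /=; case: ltnP => [_|ge].
  by rewrite factS natrM mulrA mulfVK // pnatr_eq0.
by rewrite nth_default // !mul0r.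
Qed.

Lemma primitive0 A : (primitive A)`_0 = 0.
Proof. by rewrite coef_poly /= invr0 mulr0. Qed.

Lemma egf_coef_twisted e A j : egf_coef (twisted_primitive e A) j =
  \sum_(i < size A) (-1) ^+ i * e ^+ i.+1 * egf_coef A (i + j).
Proof.
rewrite /egf_coef coef_sum mulr_suml; apply: eq_bigr => i _.
by rewrite coefZ -mulrA -/(egf_coef _ _) egf_coef_derivn.
Qed.

(* The weight [(2 c) ^+ j] makes the bound stable, up to a factor [2 c],
   under both kinds of primitives. *)
Definition int_bounded (c : nat) (b : K) A : Prop := forall j,
  exists2 z : int, egf_coef A j = z%:~R &
    `|z|%:~R * (2 * c%:R) ^+ j <= b.

Lemma int_bounded_le c b b' A : b <= b' ->
  int_bounded c b A -> int_bounded c b' A.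
Proof.
move=> bb' Ab j; have [z zE zb] := Ab j.
by exists z; rewrite // (le_trans zb).
Qed.

Lemma int_bounded_ge0 c b A : int_bounded c b A -> 0 <= b.
Proof.
by move=> /(_ 0%N)[z _]; apply: le_trans; rewrite mulr_ge0 ?exprn_ge0 ?mulr_ge0 ?ler0z.
Qed.

Lemma sum_half_le2 n : \sum_(i < n) 2^-1 ^+ i <= 2 :> K.
Proof.
have -> : \sum_(i < n) 2^-1 ^+ i = 2 - 2 * 2^-1 ^+ n :> K.
  elim: n => [|n IHn]; first by rewrite big_ord0 expr0 mulr1 subrr.
  by rewrite big_ord_recr /= IHn exprS; field.
by rewrite gerDl oppr_le0 mulr_ge0 ?exprn_ge0 ?invr_ge0.
Qed.

(** In the sum for index j, the i-th term is at most c^(i+1) b / (2c)^(i+j). With the weight (2c)^j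
    it becomes c b / 2^i, and the geometric series sums to at most 2 c b. *)
Lemma int_bounded_twisted c b (e : int) A : (0 < c)%N -> (`|e| <= c)%N ->
  int_bounded c b A -> int_bounded c (2 * c%:R * b) (twisted_primitive e%:~R A).
Proof.
move=> c0 ec Ab j; rewrite egf_coef_twisted.
have b0 := int_bounded_ge0 Ab.
have {Ab} /choice[z zP] : forall i, exists z : int, egf_coef A i = z%:~R /\
    `|z|%:~R * (2 * c%:R) ^+ i <= b.
  by move=> i; have [z ? ?] := Ab i; exists z.
exists (\sum_(i < size A) (-1) ^+ i * e ^+ i.+1 * z (i + j)%N).
  rewrite rmorph_sum; apply: eq_bigr => i _.
  by rewrite !rmorphM !rmorphXn /= rmorphN1 (zP _).1.
apply: le_trans (_ : (\sum_(i < size A) c%:R * b * 2^-1 ^+ i) <= _); last first.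
  rewrite -mulr_sumr [leRHS](_ : _ = c%:R * b * 2); last by ring.
  by rewrite ler_wpM2l ?sum_half_le2 // mulr_ge0.
apply: le_trans (_ : (\sum_(i < size A)
    `|(-1) ^+ i * e ^+ i.+1 * z (i + j)%N|)%:~R * (2 * c%:R) ^+ j <= _).
  by rewrite ler_wpM2r ?exprn_ge0 ?mulr_ge0 // ler_int ler_norm_sum.
rewrite rmorph_sum mulr_suml; apply: ler_sum => i _ /=.
rewrite !normrM normrX normrN1 expr1n mul1r normrX intrM rmorphXn /=.
have c0' : (0 : K) < c%:R by rewrite ltr0n.
have e1 : `|e|%:~R ^+ i.+1 <= c%:R ^+ i.+1 :> K.
  rewrite lerXn2r ?nnegrE ?ler0z //.
  by rewrite -[c%:R]/(c%:Z%:~R) ler_int -abszE lez_nat.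
have -> : c%:R * b * 2^-1 ^+ i = c%:R ^+ i.+1 * (b / (2 * c%:R) ^+ i).
  by rewrite exprMn exprVn exprS; field; rewrite !expf_neq0 // gt_eqF.
rewrite -mulrA ler_pM ?exprn_ge0 ?ler0z //.
rewrite ler_pdivlMr ?exprn_gt0 ?mulr_gt0 //.
by rewrite -mulrA -exprD addnC; exact: (zP _).2.
Qed.

Lemma int_bounded_primitive c b A : (0 < c)%N ->
  int_bounded c b A -> int_bounded c (2 * c%:R * b) (primitive A).
Proof.
move=> c0 Ab [|j].
  exists 0; first by rewrite /egf_coef primitive0 mul0r.
  by rewrite normr0 mul0r !mulr_ge0 // (int_bounded_ge0 Ab).
have [z zE zb] := Ab j; exists z; first by rewrite egf_coef_primitive.
by rewrite exprS mulrCA ler_wpM2l // mulr_ge0.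
Qed.

Lemma int_bounded_subC c b b' A x : int_bounded c b A ->
  (exists2 z : int, x = z%:~R & `|z|%:~R <= b') ->
  int_bounded c (b + b') (A - x%:P).
Proof.
move=> Ab [z xz zb] j; have [y yE yb] := Ab j.
have b'0 : 0 <= b' by apply: le_trans zb; rewrite ler0z.
rewrite /egf_coef coefB coefC mulrBl -/(egf_coef A j) yE.
case: j yE yb => [|j] _ yb /=.
  exists (y - z); first by rewrite xz fact0 mulr1 rmorphB.
  move: yb; rewrite !expr0 !mulr1 => yb.
  by apply: le_trans (lerD yb zb); rewrite -intrD ler_int ler_normB.
exists y; first by rewrite mul0r subr0.
by apply: le_trans yb _; rewrite lerDl.
Qed.

End ExponentialPolynomials.

(** * Hermite-Pade forms *)

Section HermitePade.
Variables (R : realType) (m : nat).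
Implicit Types (k l : 'I_m.+1) (t : R).

(** The denominator m! makes the inverse m!/(k - l) of every nonzero frequency gap an integer,
    because |k - l| <= m. *)
Definition freq k : R := k%:R / m`!%:R.

Definition inv_gap k l : int := (m`!%:Z %/ (k%:Z - l%:Z))%Z.

Lemma inv_gapE k l : k != l -> inv_gap k l * (k%:Z - l%:Z) = m`!%:Z.
Proof.
move=> kl; apply: intdiv.divzK; rewrite intdiv.dvdzE; apply: dvdn_fact.
have := ltn_ord k; have := ltn_ord l; move: kl; rewrite -val_eqE /=; lia.
Qed.

Lemma inv_gap_le k l : k != l -> (`|inv_gap k l| <= m`!)%N.
Proof.
move=> kl; have /(congr1 absz) := inv_gapE kl; rewrite abszM /= => <-.
by rewrite leq_pmulr // absz_gt0 subr_eq0 eqz_nat.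
Qed.

Lemma freq_gap k l : k != l ->
  (inv_gap k l)%:~R * (freq k - freq l)%:C = 1 :> R[i].
Proof.
move=> kl; rewrite /freq -mulrBl.
have m0 : m`!%:R != 0 :> R by rewrite pnatr_eq0 -lt0n fact_gt0.
have /(congr1 (fun z : int => z%:~R : R)) := inv_gapE kl.
rewrite intrM intrB /= => E.
rewrite -(rmorph_int (real_complex R)) -rmorphM mulrA E.
by rewrite mulfV // rmorph1.
Qed.

Definition pade_step l (A : 'I_m.+1 -> {poly R[i]}) k : {poly R[i]} :=
  if k == l then primitive (A l) -
    (\sum_(j | j != l) (twisted_primitive (inv_gap j l)%:~R (A j))`_0)%:P
  else twisted_primitive (inv_gap k l)%:~R (A k).

(** The initial constants expand (e^(it/m!) - 1)^m. The index of the step runs cyclically, so that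
    the degrees of the m+1 polynomials grow evenly. *)
Fixpoint pade s : 'I_m.+1 -> {poly R[i]} :=
  if s is s'.+1 then pade_step (inord (s' %% m.+1)) (pade s')
  else fun k => ((-1) ^+ (m - k) *+ 'C(m, k))%:P.

Definition pade_form s t : R[i] :=
  \sum_k (pade s k).['i%C * t%:C] * cis (freq k * t).

Lemma pade_formS0 s : pade_form s.+1 0 = 0.
Proof.
rewrite /pade_form; under eq_bigr do
  rewrite [0%:C]rmorph0 !mulr0 cis0 mulr1 horner_coef0.
rewrite /= /pade_step (bigD1 (inord (s %% m.+1))) //= eqxx coefB coefC /=.
rewrite primitive0 sub0r; apply/eqP; rewrite addrC subr_eq0; apply/eqP.
by apply: eq_bigr => j /negPf->.
Qed.

Lemma deriv_pade_step l A k :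
  (pade_step l A k)^`() + (freq k - freq l)%:C *: pade_step l A k = A k.
Proof.
rewrite /pade_step; case: eqVneq => [->|kl].
  by rewrite subrr rmorph0 scale0r addr0 derivB derivC subr0 deriv_primitive.
by rewrite twisted_primitiveE // freq_gap.
Qed.

Lemma is_cderive_pade_form s t (l := inord (s %% m.+1) : 'I_m.+1) :
  is_cderive (pade_form s.+1) t
    ('i%C * (freq l)%:C * pade_form s.+1 t + 'i%C * pade_form s t).
Proof.
have -> : 'i%C * (freq l)%:C * pade_form s.+1 t + 'i%C * pade_form s t =
  \sum_k ('i%C * (pade s.+1 k)^`().['i%C * t%:C] * cis (freq k * t) +
    (pade s.+1 k).['i%C * t%:C] * ('i%C * (freq k)%:C * cis (freq k * t))).
  rewrite /pade_form !mulr_sumr -big_split; apply: eq_bigr => k _ /=.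
  rewrite -[in X in _ + X](deriv_pade_step l (pade s) k) hornerD hornerZ.
  by rewrite rmorphB; ring.
apply: is_cderive_sum => k.
exact: is_cderiveM (is_cderive_horner _ _) (is_cderive_cis _ _).
Qed.

Lemma normc_cisB1 (x : R) t : 0 <= x -> 0 <= t ->
  normc (cis (x * t) - 1) <= 2 * x * t.
Proof.
move=> x0 t0; have -> : 2 * x * t = 2 * x * t ^+ 1 / 1`!%:R.
  by rewrite -[1`!]/1%N divr1.
apply: (@normc_le_integral _ (fun t => cis (x * t) - 1)
  (fun t => 'i%C * x%:C * cis (x * t) + 0) x 0) => //.
- move=> y; apply: is_cderiveD; first exact: is_cderive_cis.
  exact: is_cderive_cst.
- by rewrite mulr0 cis0 subrr.
- move=> y _; rewrite addr0 !normcM normc_i normc_cis normc_real mul1r mulr1.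
  by rewrite expr0 mulr1 fact0 divr1 ger0_norm.
Qed.

Lemma pade_form0 t : pade_form 0 t = (cis (m`!%:R^-1 * t) - 1) ^+ m.
Proof.
rewrite addrC exprDn; apply: eq_bigr => k _ /=.
rewrite hornerC -cisMn mulrnAl; congr ((_ * cis _) *+ _).
by rewrite /freq -[RHS]mulr_natl mulrA.
Qed.

Lemma normc_pade_form s t : 0 <= t ->
  normc (pade_form s t) <=
  2 ^+ m * m`!%:R * 2 ^+ s * t ^+ (s + m) / (s + m)`!%:R.
Proof.
have m0 : 0 < m`!%:R :> R by rewrite ltr0n fact_gt0.
elim: s t => [|s IHs] t t0.
  (* At [s = 0] the factor m! cancels the denominator, and the claim is the m-th power of |e^(it/m!)
     - 1| <= 2t. *)
  rewrite pade_form0 normcX expr0 mulr1 mulrAC mulfK ?gt_eqF // -exprMn.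
  apply: lerXn2r; rewrite ?nnegrE ?normc_ge0 ?mulr_ge0 //.
  apply: le_trans (normc_cisB1 _ t0) _; first by rewrite invr_ge0 ltW.
  rewrite ler_wpM2r // ler_piMr // invf_le1 // ler1n fact_gt0 //.
pose l : 'I_m.+1 := inord (s %% m.+1).
(* The integrating factor has modulus 1 and removes the term in [freq l]: the derivative of the
   product has the same modulus as the previous form. *)
have -> : normc (pade_form s.+1 t) =
    normc (cis (- freq l * t) * pade_form s.+1 t).
  by rewrite normcM normc_cis mul1r.
have -> : 2 ^+ m * m`!%:R * 2 ^+ s.+1 = 2 * (2 ^+ m * m`!%:R * 2 ^+ s) :> R.
  by rewrite exprS; ring.
apply: (@normc_le_integral _ (fun t => cis (- freq l * t) * pade_form s.+1 t)
  (fun t => 'i%C * (- freq l)%:C * cis (- freq l * t) * pade_form s.+1 t +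
  cis (- freq l * t) *
    ('i%C * (freq l)%:C * pade_form s.+1 t + 'i%C * pade_form s t))) => //.
- move=> x; apply: is_cderiveM; first exact: is_cderive_cis.
  exact: is_cderive_pade_form.
- by rewrite pade_formS0 mulr0.
- move=> x x0; set z := (X in normc X <= _).
  have -> : z = 'i%C * cis (- freq l * x) * pade_form s x.
    by rewrite /z rmorphN; ring.
  by rewrite !normcM normc_i normc_cis !mul1r; exact: IHs.
Qed.

(** Each primitive costs a factor 2 m!. The coefficient of index [l] also receives a constant that
    sums m values of that size, hence the factor m+1. The initial binomial coefficients are at most
    2^m. *)
Lemma pade_bounded s k :
  int_bounded m`! (2 ^+ m * (2 * m`!%:R * m.+1%:R) ^+ s : R) (pade s k).
Proof.
have m0 : (0 < m`!)%N := fact_gt0 m.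
elim: s k => [|s IHs] k.
  move=> j /=; rewrite expr0 mulr1 /egf_coef coefC.
  case: j => [|j] /=; last by exists 0; rewrite ?mul0r // normr0 mul0r exprn_ge0.
  exists ((-1) ^+ (m - k) *+ 'C(m, k)).
    by rewrite fact0 mulr1 rmorphMn rmorphXn /= rmorphN1.
  rewrite expr0 mulr1 normrMn normrX normrN1 expr1n.
  rewrite -[X in X%:~R]/('C(m, k)%:R) natz -[_%:~R]/('C(m, k)%:R : R).
  rewrite -natrX ler_nat -[2%N]/(1 + 1)%N expnDn (bigD1 k) //=.
  by rewrite !exp1n !muln1 leq_addr.
set b := _ * _ ^+ s in IHs; have b0 : 0 <= b := int_bounded_ge0 (IHs k).
have bS : 2 ^+ m * (2 * m`!%:R * m.+1%:R) ^+ s.+1 =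
    2 * m`!%:R * b + m%:R * (2 * m`!%:R * b).
  by rewrite exprS /b -natr1; ring.
have m2b : 0 <= 2 * m`!%:R * b by rewrite !mulr_ge0.
rewrite /= bS /pade_step; set l := inord _; case: eqVneq => [_|kl]; last first.
  apply: int_bounded_le (int_bounded_twisted m0 (inv_gap_le kl) (IHs k)).
  by rewrite lerDl mulr_ge0.
apply: int_bounded_subC; first exact: int_bounded_primitive.
have tw j : j != l -> exists z : int,
    (twisted_primitive (inv_gap j l)%:~R (pade s j))`_0 = z%:~R /\
    `|z|%:~R <= 2 * m`!%:R * b.
  move=> jl; have [z] := int_bounded_twisted m0 (inv_gap_le jl) (IHs j) 0%N.
  by rewrite /egf_coef fact0 !mulr1 => ? ?; exists z.
have /choice[z zP] : forall j, exists z : int, j != l ->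
    (twisted_primitive (inv_gap j l)%:~R (pade s j))`_0 = z%:~R /\
    `|z|%:~R <= 2 * m`!%:R * b.
  move=> j; have [_|/tw[z zP]] := eqVneq j l; last by exists z.
  by exists 0.
exists (\sum_(j | j != l) z j).
  by rewrite rmorph_sum; apply: eq_bigr => j /zP[].
apply: le_trans (_ : (\sum_(j | j != l) `|z j|)%:~R <= _).
  by rewrite ler_int ler_norm_sum.
rewrite rmorph_sum /=.
apply: le_trans (_ : \sum_(j | j != l) 2 * m`!%:R * b <= _).
  by apply: ler_sum => j /zP[].
by rewrite sumr_const cardC1 card_ord -[leLHS]mulr_natl.
Qed.

(** Only the plain primitive raises a degree, so the degree counts the steps of index [k]. *)
Definition pade_deg s k : nat := \sum_(i < s) (i %% m.+1 == k).

Lemma size_pade s k : size (pade s k) = (pade_deg s k).+1.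
Proof.
elim: s k => [|s IHs] k.
  rewrite /pade_deg big_ord0 /= size_polyC -mulr_natr mulf_neq0 //.
    by rewrite signr_eq0.
  by rewrite pnatr_eq0 -lt0n bin_gt0 -ltnS.
rewrite /pade_deg big_ord_recr -/(pade_deg s k) /= /pade_step.
have mod_s : (s %% m.+1 < m.+1)%N by rewrite ltn_mod.
rewrite -val_eqE /= inordK // eq_sym; case: eqP => [sk|/eqP sk]; last first.
  rewrite (size_twisted_primitive _ (freq_gap _)) ?IHs ?addn0 //.
  by rewrite -val_eqE /= inordK // eq_sym.
have -> : inord (s %% m.+1) = k by apply: val_inj; rewrite /= inordK.
have A0 : pade s k != 0 by rewrite -size_poly_gt0 IHs.
rewrite size_polyDl ?size_primitive ?IHs ?addn1 //.
by rewrite size_polyN size_polyC; case: (_ != _).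
Qed.

Lemma pade_degE n j k : (j <= m.+1)%N ->
  pade_deg (n * m.+1 + j) k = (n + (k < j))%N.
Proof.
rewrite /pade_deg => jm.
elim: j jm => [_|j IHj jm].
  rewrite addn0 ltn0 addn0; elim: n => [|n IHn].
    by rewrite mul0n big_ord0.
  rewrite mulSnr -(big_mkord xpredT (fun i => ((i %% m.+1)%N == k : nat))).
  rewrite (big_cat_nat (n := n * m.+1)) ?leq_addr //= big_mkord IHn.
  rewrite -{1}[(n * m.+1)%N]add0n big_addn addKn big_mkord.
  rewrite (eq_bigr (fun i : 'I_m.+1 => (i == k : nat))) => [|i _].
    rewrite (bigD1 k) //= eqxx big1 ?addn0 ?addn1 // => i /negPf.
    by rewrite -val_eqE /= => ->.
  by rewrite addnC modnMDl modn_small.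
rewrite addnS big_ord_recr /= (IHj (ltnW jm)) -addnA modnMDl modn_small //.
rewrite ltnS; congr (_ + _)%N.
by have [] := ltngtP k j.
Qed.

End HermitePade.

(** * Nonvanishing *)

Section TopCoefficient.
Variable F : comNzRingType.

Lemma coefM_top (p q : {poly F}) a b : (size p <= a.+1)%N -> (size q <= b.+1)%N ->
  (p * q)`_(a + b) = p`_a * q`_b.
Proof.
move=> pa qb; have lt_a : (a < (a + b).+1)%N by rewrite ltnS leq_addr.
rewrite coefM (bigD1 (Ordinal lt_a)) //= addKn big1 ?addr0 // => i.
rewrite -val_eqE /= neq_ltn => /orP[ia|ai].
  by rewrite [q`__]nth_default ?mulr0 // (leq_trans qb); lia.
by rewrite [p`__]nth_default ?mul0r // (leq_trans pa).
Qed.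

Lemma coef_prod_top (I : Type) (r : seq I) (p : I -> {poly F}) d :
  (forall i, (size (p i) <= d.+1)%N) ->
  (size (\prod_(i <- r) p i)%R <= (size r * d).+1)%N /\
  (\prod_(i <- r) p i)`_(size r * d) = \prod_(i <- r) (p i)`_d.
Proof.
move=> pd; elim: r => [|i r [IHs IHc]].
  by rewrite !big_nil mul0n coef1 size_poly1.
rewrite !big_cons /= mulSn coefM_top // IHc; split => //.
apply: leq_trans (size_polyMleq _ _) _; move: (pd i) IHs.
by move: (size (p i)) (size (\prod_(j <- r) p j)%R) (size r * d)%N; lia.
Qed.

(** The entries need not reach degree [d]; a degree drop shows up as a zero in the matrix of top
    coefficients. *)
Lemma coef_det_top n d (M : 'M[{poly F}]_n) :
  (forall i j, (size (M i j) <= d.+1)%N) ->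
  (size (\det M) <= (n * d).+1)%N /\
  (\det M)`_(n * d) = \det (map_mx (fun p : {poly F} => p`_d) M).
Proof.
move=> Md.
have top (s : 'S_n) := coef_prod_top (index_enum 'I_n)
  (fun i => Md i (s i)).
have szn : size (index_enum 'I_n) = n by rewrite -[RHS]card_ord cardT enumT.
rewrite szn in top; rewrite /determinant; split.
  apply: leq_trans (size_sum _ _ _) _; apply/bigmax_leqP => s _.
  by rewrite mulr_sign; case: ifP; rewrite ?size_polyN (top s).1.
rewrite coef_sum; apply: eq_bigr => s _.
rewrite !mulr_sign; case: ifP => _; rewrite ?coefN (top s).2;
  by [congr (- _); apply: eq_bigr => i _; rewrite mxE |
      apply: eq_bigr => i _; rewrite mxE].
Qed.

End TopCoefficient.

(** * The determinant of m+1 consecutive forms *)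

Section HermitePadeDeterminant.
Variable R : realType.

Lemma normc_horner_le (p : {poly R[i]}) (t : R) : 0 <= t <= 1 ->
  normc p.['i%C * t%:C] <= \sum_(j < size p) normc p`_j.
Proof.
move=> /andP[t0 t1]; rewrite horner_coef.
apply: le_trans (normc_sum _ _ _) _; apply: ler_sum => j _.
rewrite normcM normcX normcM normc_i normc_real mul1r ger0_norm //.
by rewrite ler_piMr ?normc_ge0 // exprn_ile1.
Qed.

(** Small values of [t] force the constant coefficient to vanish; dividing by X then lowers [d] by
    one. *)
Lemma coef_eq0_of_small (p : {poly R[i]}) (C : R) d :
  (forall t, 0 < t <= 1 -> normc p.['i%C * t%:C] <= C * t ^+ d) ->
  forall j, (j < d)%N -> p`_j = 0.
Proof.
elim: d p C => // d IHd p C; elim/poly_ind: p => [|p c _] pC.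
  by move=> j _; rewrite coef0.
pose B := \sum_(j < size p) normc p`_j.
have B0 : 0 <= B by apply: sumr_ge0 => j _; exact: normc_ge0.
have le_t t : 0 < t <= 1 -> normc c <= (B + `|C|) * t.
  move=> /andP[t0 t1].
  have -> : c = (p * 'X + c%:P).['i%C * t%:C] - p.['i%C * t%:C] * ('i%C * t%:C).
    by rewrite hornerMXaddC addrC addKr.
  apply: le_trans (le_normcD _ _) _; rewrite normcN addrC mulrDl lerD //.
    rewrite !normcM normc_i normc_real mul1r gtr0_norm // ler_wpM2r ?(ltW t0) //.
    by apply: normc_horner_le; rewrite t1 (ltW t0).
  apply: le_trans (pC _ _) _; first by rewrite t0.
  rewrite exprS mulrA; apply: le_trans (_ : `|C| * t <= _) => //.
  rewrite -mulrA [t * _]mulrC mulrA; apply: ler_wpM2r; first exact: ltW.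
  apply: le_trans (ler_norm _) _; rewrite normrM.
  by rewrite ler_piMr // normrX exprn_ile1 // gtr0_norm.
have c0 : c = 0.
  apply/eqP; rewrite -normc_eq0 eq_le normc_ge0 andbT.
  rewrite leNgt; apply/negP => cgt.
  set K := B + `|C| in le_t.
  have K0 : 0 <= K by rewrite addr_ge0.
  have D0 : 0 < 2 * K + normc c by rewrite ltr_wpDl // mulr_ge0.
  (* This point lies in ]0, 1], and there the bound |c| <= K t would give 2 K + |c| <= K. *)
  have := le_t (normc c / (2 * K + normc c)).
  rewrite divr_gt0 // ler_pdivrMr // mul1r lerDr mulr_ge0 // => /(_ isT).
  rewrite mulrA ler_pdivlMr //.
  rewrite [leRHS]mulrC ler_pM2l //; lra.
rewrite c0 addr0 in pC *; case=> [|j]; rewrite coefMX //= ltnS => jd.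
apply: (IHd p C) => // t t01; have /andP[t0 _] := t01.
have := pC _ t01.
rewrite hornerMX !normcM normc_i normc_real mul1r gtr0_norm // exprSr mulrA.
by rewrite ler_pM2r.
Qed.

(** The determinant of the coefficient matrix [M] has degree at most (m+1)(n+1), and all its
    coefficients below that degree vanish. It is thus a nonzero monomial, so [Mt t] is invertible
    and cannot kill the nonzero vector [u t]. *)
Lemma pade_form_neq0 m n (t : R) : 0 < t ->
  exists j : 'I_m.+1, pade_form m (n * m.+1 + j.+1) t != 0.
Proof.
move=> t0.
pose M : 'M[{poly R[i]}]_m.+1 := \matrix_(j, k) pade R (n * m.+1 + j.+1) k.
pose Mt (x : R) := map_mx (horner_eval ('i%C * x%:C)) M.
pose u (x : R) : 'cV[R[i]]_m.+1 := \col_k cis (freq R k * x).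
have Mu x j : (Mt x *m u x) j 0 = pade_form m (n * m.+1 + j.+1) x.
  by rewrite mxE; apply: eq_bigr => k _; rewrite !mxE.
have detE x : (\det M).['i%C * x%:C] = \det (Mt x).
  by rewrite det_map_mx.
have u0 x : u x 0 0 = 1 by rewrite mxE /freq !mul0r cis0.
have szM j k : (size (M j k) <= n.+2)%N.
  by rewrite mxE size_pade pade_degE // ltnS -[n.+1]addn1 leq_add2l leq_b1.
have [szdet coefdet] := coef_det_top szM.
(* Row j reaches degree n+1 exactly in the columns k <= j, so the matrix of top coefficients is
   triangular with nonzero diagonal. *)
have top : (\det M)`_(m.+1 * n.+1) != 0.
  rewrite coefdet det_trig; last first.
    apply/is_trig_mxP => j k jk; rewrite !mxE nth_default // size_pade.
    by rewrite pade_degE // ltnS ltnNge jk addn0.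
  apply/prodf_neq0 => j _; rewrite !mxE.
  have := size_pade R (n * m.+1 + j.+1) j; rewrite pade_degE // ltnSn addn1.
  move=> sz; have := lead_coef_eq0 (pade R (n * m.+1 + j.+1) j).
  by rewrite /lead_coef sz -size_poly_eq0 sz /= => ->.
pose c (j : 'I_m.+1) : R :=
  (2 ^+ m * m`!%:R * 2 ^+ (n * m.+1 + j.+1)) / (n * m.+1 + j.+1 + m)`!%:R.
pose a (j : 'I_m.+1) : R := \sum_(k < size ((\adj M) 0 j)) normc ((\adj M) 0 j)`_k.
(* By the adjugate and [u x 0 0 = 1], the determinant is a combination of the forms, each of order
   at least (m+1)(n+1) at 0. *)
have low j : (j < m.+1 * n.+1)%N -> (\det M)`_j = 0.
  apply: (@coef_eq0_of_small _ (\sum_j a j * c j)) => x /andP[x0 x1].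
  have /matrixP/(_ 0 0) : \adj (Mt x) *m (Mt x *m u x) = \det (Mt x) *: u x.
    by rewrite mulmxA mul_adj_mx mul_scalar_mx.
  rewrite [RHS]mxE u0 mulr1 detE => <-; rewrite mxE.
  apply: le_trans (normc_sum _ _ _) _; rewrite mulr_suml; apply: ler_sum => k _.
  rewrite normcM Mu -map_mx_adj mxE -mulrA ler_pM ?normc_ge0 //.
    by rewrite /horner_eval normc_horner_le // ltW.
  apply: le_trans (normc_pade_form _ _ (ltW x0)) _.
  rewrite mulrAC /c ler_wpM2l ?mulr_ge0 ?invr_ge0 ?exprn_ge0 //.
  by rewrite ler_wiXn2l ?(ltW x0) //; nia.
have det0 : (\det M).['i%C * t%:C] != 0.
  rewrite (horner_coef_wide _ szdet) big_ord_recr /= big1 ?add0r => [|j _].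
    rewrite mulf_neq0 // expf_neq0 // -normc_eq0 normcM normc_i normc_real.
    by rewrite mul1r normr_eq0 gt_eqF.
  by rewrite low ?mul0r.
have [/existsP[j jP]|/existsPn all0] := boolP
    [exists j : 'I_m.+1, pade_form m (n * m.+1 + j.+1) t != 0].
  by exists j.
case/negP: det0; rewrite detE -[\det _]mulr1 -(u0 t).
have -> : \det (Mt t) * u t 0 0 = (\adj (Mt t) *m (Mt t *m u t)) 0 0.
  by rewrite mulmxA mul_adj_mx mul_scalar_mx [RHS]mxE.
rewrite mxE big1 // => j _; rewrite Mu.
by have := all0 j; rewrite negbK => /eqP->; rewrite mulr0.
Qed.

End HermitePadeDeterminant.

(** * The Hermite-Lindemann theorem *)

Section PadeEigen.
Variables (R : realType) (m D : nat) (v : 'rV[R[i]]_D) (d : int) (H x : R).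
Hypotheses (d0 : d != 0) (H0 : 0 <= H).
Hypothesis eigx : int_eigen v H (d%:~R * ('i%C * x%:C)).
Hypothesis eigy : int_eigen v H (d%:~R * cis x).

(** The added 1 gives h >= 1, so exponents may be enlarged in upper bounds. *)
Let h : R := D.+1%:R * H + 1.

(** The factors count, in turn, the frequencies, the monomials of degree at most [N], two matrix
    products, the integer coefficient, and the powers of the two eigenvalues. *)
Definition pade_height (N : nat) : R :=
  m.+1%:R * (N.+1%:R * (D.+1%:R ^+ 2 * ((2 ^+ m *
  (2 * m`!%:R * m.+1%:R) ^+ (N * m.+1) * N`!%:R * m`!%:R ^+ N *
  `|d|%:~R ^+ (N + m)) * h ^+ (N + m)))).

(** At the point m! x the exponentials are the powers [cis x ^+ k]. The factor N! clears the
    denominators i!, and d^(N+m) supplies one [d] for each factor [x] or [cis x]. *)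
Lemma pade_form_eigen n (j : 'I_m.+1) : int_eigen v (pade_height n.+1)
  ((n.+1)`!%:R * d%:~R ^+ (n.+1 + m) *
   pade_form m (n * m.+1 + j.+1) (m`!%:R * x)).
Proof.
set N := n.+1; set s := (n * m.+1 + j.+1)%N.
have m0 : m`!%:R != 0 :> R by rewrite pnatr_eq0 -lt0n fact_gt0.
have d1 : 1 <= `|d|%:~R :> R by rewrite ler1z -gtz0_ge1 normr_gt0.
have h1 : 1 <= h by rewrite /h lerDr mulr_ge0.
have m1 : 1 <= m`!%:R :> R by rewrite ler1n fact_gt0.
have K1 : 1 <= 2 * m`!%:R * m.+1%:R :> R.
  by rewrite -!natrM ler1n !muln_gt0 fact_gt0.
have sz (k : 'I_m.+1) : (size (pade R s k) <= N.+1)%N.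
  by rewrite size_pade /s pade_degE // ltnS -[N]addn1 leq_add2l leq_b1.
pose B : R := 2 ^+ m * (2 * m`!%:R * m.+1%:R) ^+ (N * m.+1).
have /choice[z zP] : forall k : 'I_m.+1, exists z : nat -> int, forall i,
    egf_coef (pade R s k) i = (z i)%:~R /\ `|z i|%:~R <= B.
  move=> k; suff /choice[f fP] : forall i, exists z : int,
      egf_coef (pade R s k) i = z%:~R /\ `|z|%:~R <= B by exists f.
  move=> i.
  have [z zE zB] := pade_bounded R s k i; exists z; split => //.
  have c1 : 1 <= (2 * m`!%:R) ^+ i :> R.
    by rewrite exprn_ege1 // -natrM ler1n muln_gt0 fact_gt0.
  apply: le_trans (_ : `|z|%:~R * (2 * m`!%:R) ^+ i <= _).
    by rewrite ler_peMr ?ler0z.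
  apply: le_trans zB _; rewrite ler_wpM2l ?exprn_ge0 //.
  by rewrite ler_weXn2l // /s /N mulSnr leq_add2l.
(* The falling factorial is N!/i!, the power of m! comes from the argument m! x, and the power of
   [d] is what the monomial leaves over. *)
pose W k i : int := z k i * (N ^_ (N - i))%:Z * (m`!)%:Z ^+ i *
  d ^+ (N - i + (m - k)).
have -> : N`!%:R * d%:~R ^+ (N + m) * pade_form m s (m`!%:R * x) =
    \sum_(k < m.+1) \sum_(i < N.+1) (W k i)%:~R *
      ((d%:~R * ('i%C * x%:C)) ^+ i * (d%:~R * cis x) ^+ k).
  rewrite /pade_form mulr_sumr; apply: eq_bigr => k _.
  have -> : cis (freq R k * (m`!%:R * x)) = cis x ^+ k.
    by rewrite -cisMn -[x *+ k]mulr_natl /freq mulrA divfK.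
  rewrite (horner_coef_wide _ (sz k)) mulr_suml mulr_sumr.
  apply: eq_bigr => i _; have iN : (i <= N)%N by rewrite -ltnS.
  have km : (k <= m)%N by rewrite -ltnS.
  rewrite egf_coefE (zP k i).1 /W !intrM !rmorphXn /=.
  have i0 : i`!%:R != 0 :> R[i] by rewrite pnatr_eq0 -lt0n fact_gt0.
  have -> : N`!%:R = (N ^_ (N - i))%:R * i`!%:R :> R[i].
    by have := ffact_fact (leq_subr i N); rewrite subKn // -natrM => ->.
  have -> : d%:~R ^+ (N + m) = d%:~R ^+ (N - i + (m - k)) * d%:~R ^+ i *
      d%:~R ^+ k :> R[i].
    by rewrite -!exprD; congr (_ ^+ _); lia.
  rewrite !exprMn rmorphM rmorph_nat !exprMn.
  by field.
rewrite /pade_height; set Y := (D.+1%:R ^+ 2 * _).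
have -> : m.+1%:R * (N.+1%:R * Y) = \sum_(k < m.+1) \sum_(i < N.+1) Y.
  by rewrite !sumr_const !card_ord !mulr_natl.
rewrite {}/Y.
apply: int_eigen_sum => k; apply: int_eigen_sum => i.
have iN : (i <= N)%N by rewrite -ltnS.
have km : (k <= m)%N by rewrite -ltnS.
have e1 := int_eigenM (int_eigenX i H0 eigx) (int_eigenX k H0 eigy).
apply: int_eigen_le (int_eigenM (int_eigen_int v (W k i)) e1).
have hh a : (D.+1%:R * H) ^+ a <= h ^+ a.
  by rewrite lerXn2r ?nnegrE ?lerDl ?mulr_ge0 // (le_trans ler01).
have hX : (D.+1%:R * H) ^+ i * (D.+1%:R * H) ^+ k <= h ^+ (N + m).
  rewrite exprD ler_pM ?exprn_ge0 ?mulr_ge0 //.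
    by apply: le_trans (hh _) _; rewrite ler_weXn2l.
  by apply: le_trans (hh _) _; rewrite ler_weXn2l.
have WX : `|W k i|%:~R <= B * N`!%:R * m`!%:R ^+ N * `|d|%:~R ^+ (N + m).
  rewrite /W !normrM !intrM !normrX !rmorphXn /=.
  rewrite !ler_pM ?mulr_ge0 ?exprn_ge0 ?ler0z //.
  - exact: (zP k i).2.
  - rewrite -[_%:~R]/((N ^_ (N - i))%:R) ler_nat.
    rewrite -(ffact_fact (leq_subr i N)) leq_pmulr // fact_gt0 //.
  - by rewrite -[_%:~R]/(m`!%:R) ler_weXn2l.
  - by rewrite ler_weXn2l // leq_add ?leq_subr.
have DD : D%:R <= D.+1%:R :> R by rewrite ler_nat.
rewrite -/B expr2 -mulrA ler_pM //.
  by rewrite !mulr_ge0 ?ler0z ?exprn_ge0 ?mulr_ge0.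
rewrite mulrCA ler_pM //.
  by rewrite !mulr_ge0 ?ler0z ?exprn_ge0 ?mulr_ge0.
by rewrite ler_pM // ?ler0z !mulr_ge0 ?exprn_ge0 ?mulr_ge0.
Qed.

End PadeEigen.

(** * Geometric growth against factorials *)

Section GeometricGrowth.
Variable R : realType.
Implicit Types f g : nat -> R.

(** The exponent n+1 instead of n absorbs constant factors, also at n = 0. *)
Definition geometric_growth f : Prop :=
  exists c : R, forall n, 0 <= f n <= c ^+ n.+1.

Lemma geometric_growth_cst (a : R) : 0 <= a -> geometric_growth (fun=> a).
Proof.
move=> a0; exists (a + 1) => n; rewrite a0 /=.
apply: le_trans (_ : a + 1 <= _); first by rewrite lerDl.
by rewrite -[leLHS]expr1 ler_weXn2l // lerDr.
Qed.

Lemma geometric_growthX (a : R) : 0 <= a -> geometric_growth (fun n => a ^+ n).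
Proof.
move=> a0; exists (a + 1) => n; rewrite exprn_ge0 //=.
apply: le_trans (_ : (a + 1) ^+ n <= _).
  by rewrite lerXn2r ?nnegrE ?addr_ge0 ?lerDl.
by rewrite ler_weXn2l // lerDr.
Qed.

Lemma geometric_growth_succ : geometric_growth (fun n => n.+1%:R).
Proof.
by exists 2 => n; rewrite ler0n -natrX ler_nat /= ltnW // ltn_expl.
Qed.

Lemma geometric_growthM f g : geometric_growth f -> geometric_growth g ->
  geometric_growth (fun n => f n * g n).
Proof.
move=> [c fc] [d gd]; exists (c * d) => n.
have /andP[f0 fn] := fc n; have /andP[g0 gn] := gd n.
by rewrite mulr_ge0 //= exprMn ler_pM.
Qed.

Lemma geometric_growthD f g : geometric_growth f -> geometric_growth g ->
  geometric_growth (fun n => f n + g n).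
Proof.
move=> [c fc] [d gd]; exists (c + d) => n.
have c0 : 0 <= c by have /andP[] := fc 0%N; rewrite expr1; exact: le_trans.
have d0 : 0 <= d by have /andP[] := gd 0%N; rewrite expr1; exact: le_trans.
have /andP[f0 fn] := fc n; have /andP[g0 gn] := gd n.
rewrite addr_ge0 //=; apply: le_trans (lerD fn gn) _.
elim: n {f0 fn g0 gn} => [|n IHn]; first by rewrite !expr1.
rewrite exprS [d ^+ _]exprS [leRHS]exprS.
apply: le_trans (ler_wpM2l (addr_ge0 c0 d0) IHn).
have := mulr_ge0 c0 (exprn_ge0 n.+1 d0).
have := mulr_ge0 d0 (exprn_ge0 n.+1 c0).
by rewrite mulrDl !mulrDr; lra.
Qed.

Lemma geometric_growth_iterX f k : geometric_growth f ->
  geometric_growth (fun n => f n ^+ k).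
Proof.
move=> gf; elim: k => [|k IHk].
  by under eq_fun do rewrite expr0; exact: geometric_growth_cst.
by under eq_fun do rewrite exprS; exact: geometric_growthM.
Qed.

Lemma geometric_growth_affineX (a : R) k l : 0 <= a ->
  geometric_growth (fun n => a ^+ (n * k + l)).
Proof.
move=> a0; under eq_fun do rewrite exprD mulnC exprM.
by apply: geometric_growthM; [apply/geometric_growthX/exprn_ge0 |
  apply/geometric_growth_cst/exprn_ge0].
Qed.

(** Since c^n / n! tends to 0, some N has (c + 1) c^(N+1) < (N+1)!, whereas f (N+1) <= c^(N+2). *)
Lemma fact_not_geometric f : geometric_growth f ->
  ~ (forall n, n.+1`!%:R <= f n.+1).
Proof.
move=> [c fc] factf.
have c0 : 0 <= c by have /andP[] := fc 0%N; rewrite expr1; exact: le_trans.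
have c1 : 0 < (c + 1)^-1 by rewrite invr_gt0 ltr_wpDl.
have /cvgr0Pnorm_lt/(_ _ c1)[N _ /(_ N.+1 (leqnSn N))] := cvg_exp_coeff c.
have F0 : 0 < N.+1`!%:R :> R by rewrite ltr0n fact_gt0.
rewrite /exp_coeff ger0_norm ?divr_ge0 ?exprn_ge0 //.
rewrite ltr_pdivrMr // => cN.
have /andP[_] := fc N.+1; rewrite exprS => fN.
have := le_trans (factf N) fN; rewrite leNgt => /negP; apply.
apply: le_lt_trans (_ : (c + 1) * c ^+ N.+1 < _).
  by rewrite ler_wpM2r ?exprn_ge0 // lerDl.
by rewrite mulrC -ltr_pdivlMr ?ltr_wpDl // mulrC.
Qed.

End GeometricGrowth.

(** This turns the denominator ((m+1)N)! into a power of N!, comparable with the heights. *)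
Lemma expn_fact_le n k : (n`! ^ k <= (n * k)`!)%N.
Proof.
elim: k => [|k IHk]; first by rewrite muln0.
rewrite expnS mulnS -(bin_fact (leq_addr (n * k) n)) addKn.
by apply: leq_trans (leq_pmull _ _); rewrite ?bin_gt0 ?leq_addr // leq_mul2l IHk orbT.
Qed.

(** * Transcendence of e^(ix) for algebraic x > 0 *)

Section HermiteLindemann.
Variable R : realType.

Lemma algebraic_real_complex (x : R) :
  algebraicOver (ratr : rat -> R) x -> algebraicOver (ratr : rat -> R[i]) x%:C.
Proof.
case=> p p0 rp; exists p => //.
have -> : map_poly (ratr : rat -> R[i]) p =
    map_poly (real_complex R) (map_poly ratr p).
  by rewrite -map_poly_comp; apply: eq_map_poly => a /=; rewrite fmorph_rat.
by rewrite fmorph_root.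
Qed.

Lemma algebraic_i : algebraicOver (ratr : rat -> R[i]) 'i%C.
Proof.
exists ('X^2 + 1); first by rewrite -size_poly_eq0 size_XnaddC.
rewrite rmorphD rmorph1 /= map_polyXn rootE hornerD hornerXn hornerC.
by rewrite sqr_i addNr.
Qed.

Theorem lindemann_cis (x : R) : 0 < x -> algebraicOver ratr x ->
  ~ algebraicOver ratr (cis x).
Proof.
move=> x0 /algebraic_real_complex algx algcis.
have [D [v [d [H [v0 d0 H0 eigx eigy]]]]] :=
  algebraic_common_eigen (algebraic_mul algebraic_i algx) algcis.
(* This [m] gives the denominator N!^(D+2), one power more than the numerators N! and N!^D together.
   The 1 in [T] makes its powers increasing. *)
pose m := D.+1; pose T : R := m`!%:R * x + 1.
have m0 : 0 < m`!%:R :> R by rewrite ltr0n fact_gt0.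
have T1 : 1 <= T by rewrite lerDr mulr_ge0 // ltW.
have d1 : 0 <= `|d|%:~R :> R by rewrite ler0z.
have h0 : 0 <= D.+1%:R * H + 1 by rewrite addr_ge0 ?mulr_ge0.
pose G N : R := m.+1%:R * N.+1%:R * D.+1%:R ^+ 2 * 2 ^+ m *
  (2 * m`!%:R * m.+1%:R) ^+ (N * m.+1 + 0) * m`!%:R ^+ N *
  `|d|%:~R ^+ (N * 1 + m) * (D.+1%:R * H + 1) ^+ (N * 1 + m).
have GE N : pade_height m D d H N = N`!%:R * G N.
  by rewrite /pade_height /G !muln1 addn0; ring.
have geoG : geometric_growth G.
  rewrite /G; do !apply: geometric_growthM; first
    [ exact: geometric_growth_succ | exact: geometric_growthX
    | exact: geometric_growth_affineX
    | by apply: geometric_growth_affineX; rewrite !mulr_ge0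
    | by apply: geometric_growth_cst; rewrite ?exprn_ge0 ].
(* [E] collects everything in the final inequality except the powers of N!. *)
pose E N : R := `|d|%:~R ^+ (N * 1 + m) * (2 ^+ m * m`!%:R) *
  2 ^+ (N * m.+1 + 0) * T ^+ (N * m.+1 + m) * D`!%:R * (2 * (G N + 1)) ^+ D.
have T0 : 0 <= T by exact: le_trans T1.
have geoE : geometric_growth E.
  rewrite /E; do !apply: geometric_growthM; first [ exact: geometric_growth_affineX
    | by apply: geometric_growth_cst; rewrite ?mulr_ge0 ?exprn_ge0
    | apply: geometric_growth_iterX; apply: geometric_growthM;
      [exact: geometric_growth_cst | apply: geometric_growthD => //;
        exact: geometric_growth_cst] ].
apply: (fact_not_geometric geoE) => n; set N := n.+1.
have [j form0] := pade_form_neq0 m n (mulr_gt0 m0 x0).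
have := pade_form_eigen d0 H0 eigx eigy n j.
rewrite -/N; set s := (n * m.+1 + j.+1)%N in form0 *.
have G0 : 0 <= G N by have [c /(_ N)/andP[]] := geoG.
have N0 : 0 < N`!%:R :> R by rewrite ltr0n fact_gt0.
set y := (X in int_eigen _ _ X) => eig.
have y0 : y != 0.
  by rewrite !mulf_neq0 ?expf_neq0 ?intr_eq0 // pnatr_eq0 -lt0n fact_gt0.
have hgt0 : 0 <= pade_height m D d H N by rewrite GE mulr_ge0 // ltW.
have := int_eigen_lower_bound v0 y0 hgt0 eig.
rewrite GE /y !normcM normc_nat normcX normc_int.
move=> low.
have sm : (N * m.+1 <= s + m)%N.
  by rewrite /s /N mulSnr -addnA leq_add2l addSn ltnS leq_addl.
have form_le : normc (pade_form m s (m`!%:R * x)) <=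
    2 ^+ m * m`!%:R * 2 ^+ (N * m.+1) * T ^+ (N * m.+1 + m) / N`!%:R ^+ m.+1.
  have mx0 : 0 <= m`!%:R * x by rewrite mulr_ge0 // ltW.
  apply: le_trans (normc_pade_form m s mx0) _.
  have sN : (s <= N * m.+1)%N.
    by rewrite /s /N mulSnr leq_add2l.
  apply: ler_pM.
  - by rewrite !mulr_ge0 ?exprn_ge0.
  - by rewrite invr_ge0.
  - apply: ler_pM; rewrite ?mulr_ge0 ?exprn_ge0 //.
      by rewrite ler_wpM2l ?mulr_ge0 ?exprn_ge0 // ler_weXn2l // ler1n.
    apply: le_trans (_ : T ^+ (s + m) <= _).
      by rewrite lerXn2r ?nnegrE // lerDl.
    by rewrite ler_weXn2l // leq_add2r.
  - rewrite lef_pV2 ?posrE ?exprn_gt0 ?ltr0n ?fact_gt0 //.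
    rewrite -natrX ler_nat; apply: leq_trans (expn_fact_le _ _) _.
    exact: leq_fact.
have hgt2 : 0 <= 2 * (N`!%:R * G N + 1).
  by apply: mulr_ge0 => //; apply: addr_ge0 => //; apply: mulr_ge0.
have hgt_le : 2 * (N`!%:R * G N + 1) <= N`!%:R * (2 * (G N + 1)).
  by rewrite [leRHS]mulrCA ler_wpM2l // mulrDr mulr1 lerD2l ler1n fact_gt0.
have : 1 <= (N`!%:R * `|d|%:~R ^+ (N + m) *
    (2 ^+ m * m`!%:R * 2 ^+ (N * m.+1) * T ^+ (N * m.+1 + m) /
      N`!%:R ^+ m.+1)) * (D`!%:R * (N`!%:R * (2 * (G N + 1))) ^+ D).
  apply: le_trans low _; apply: ler_pM.
  - by rewrite !mulr_ge0 ?exprn_ge0 ?normc_ge0.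
  - exact/mulr_ge0/exprn_ge0.
  - by apply: ler_wpM2l form_le; rewrite mulr_ge0 ?exprn_ge0.
  - apply: ler_wpM2l => //; apply: lerXn2r; rewrite ?nnegrE //.
    exact: le_trans hgt_le.
(* The powers of N! combine to exponent 1 + D - (D+2) = -1, leaving N! <= E N. *)
have -> : (N`!%:R * `|d|%:~R ^+ (N + m) *
    (2 ^+ m * m`!%:R * 2 ^+ (N * m.+1) * T ^+ (N * m.+1 + m) /
      N`!%:R ^+ m.+1)) * (D`!%:R * (N`!%:R * (2 * (G N + 1))) ^+ D) =
    E N / N`!%:R.
  rewrite /E !muln1 addn0 exprMn /m !(exprS N`!%:R).
  by field; rewrite expf_neq0 gt_eqF.
by rewrite ler_pdivlMr // mul1r.
Qed.

End HermiteLindemann.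

(** * The escape constant *)

Section RealAlgebraic.
Variable R : realType.
Implicit Types x y : R.

Local Notation alg := (algebraicOver (ratr : rat -> R)).

Lemma algebraic_nat n : alg n%:R.
Proof. by rewrite -(ratr_nat R n); exact: algebraic_id. Qed.

Lemma algebraic_exp x n : alg x -> alg (x ^+ n).
Proof.
move=> algx; elim: n => [|n IHn]; first exact: algebraic1.
by rewrite exprS; exact: algebraic_mul.
Qed.

(** Algebraic and integral elements coincide over a field, so this is transitivity of
    integrality. *)
Lemma algebraic_root_Poly (l : seq R) x : (forall a, a \in l -> alg a) ->
  Poly l != 0 -> (Poly l).[x] = 0 -> alg x.
Proof.
move=> algl l0 /rootP rt; apply/integral_algebraic.
apply: (integral_root l0 rt) => a /(nthP 0)[i _ <-]; apply/integral_algebraic.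
rewrite coef_Poly; have [il|il] := ltnP i (size l).
  exact/algl/mem_nth.
by rewrite nth_default //; exact: algebraic0.
Qed.

Lemma algebraic_sqr x : alg (x ^+ 2) -> alg x.
Proof.
move=> algx2; apply: (@algebraic_root_Poly [:: - x ^+ 2; 0; 1]).
- move=> a; rewrite !inE => /or3P[]/eqP->.
  + exact: algebraic_opp.
  + exact: algebraic0.
  + exact: algebraic1.
- apply/eqP => /polyP/(_ 2%N); rewrite coef_Poly coef0 /= => /eqP.
  by rewrite oner_eq0.
- by rewrite horner_Poly /=; ring.
Qed.

(** Algebraicity of [cis x] expressed inside the real field, where the addition formulas apply. *)
Definition algebraic_angle x : Prop := alg (cos x) /\ alg (sin x).

Lemma algebraic_angleD x y :
  algebraic_angle x -> algebraic_angle y -> algebraic_angle (x + y).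
Proof.
move=> [cx sx] [cy sy]; rewrite /algebraic_angle cosD sinD; split.
  by apply: algebraic_sub; exact: algebraic_mul.
by apply: algebraic_add; exact: algebraic_mul.
Qed.

Lemma algebraic_angleN x : algebraic_angle x -> algebraic_angle (- x).
Proof.
by move=> [cx sx]; rewrite /algebraic_angle cosN sinN; split => //; exact: algebraic_opp.
Qed.

(** The square of the cosine is 1/(1 + x^2), and the sine is x times the cosine. *)
Lemma algebraic_angle_atan x : alg x -> algebraic_angle (atan x).
Proof.
move=> algx.
have c0 : cos (atan x) != 0.
  by rewrite gt_eqF // cos_atan invr_gt0 sqrtr_gt0 ltr_pwDl // sqr_ge0.
have algc : alg (cos (atan x)).
  apply: algebraic_sqr; rewrite cos_atan exprVn sqr_sqrtr ?addr_ge0 ?sqr_ge0 //.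
  apply: algebraic_inv; apply: algebraic_add; first exact: algebraic1.
  exact: algebraic_exp.
split => //; have -> : sin (atan x) = x * cos (atan x).
  by rewrite -{2}(atanK x) /tan divfK.
exact: algebraic_mul.
Qed.

Lemma lindemann_angle x : 0 < x -> alg x -> ~ algebraic_angle x.
Proof.
move=> x0 algx [algc algs]; apply: (lindemann_cis x0 algx).
have -> : cis x = (cos x)%:C + 'i%C * (sin x)%:C by rewrite [cis x]complexE.
apply: algebraic_add; first exact: algebraic_real_complex.
apply: algebraic_mul; first exact: algebraic_i.
exact: algebraic_real_complex.
Qed.

End RealAlgebraic.

Ltac algebraic := repeat first
  [ assumption | exact: algebraic_nat | exact: algebraic0 | exact: algebraic1
  | apply: algebraic_exp | apply: algebraic_opp | apply: algebraic_inv
  | apply: algebraic_mul | apply: algebraic_add ].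

(** * Algebraicity of the parameters and the inequality p < q *)

Section EscapeConstant.
Variable R : realType.
Import GoldenGnomon.

Local Notation alg := (algebraicOver (ratr : rat -> R)).
Local Notation c := (c R).
Local Notation s := (s R).
Local Notation p := (p R).
Local Notation q := (q R).

Lemma algebraic_c : alg c.
Proof.
apply: (@algebraic_root_Poly _ [:: - 1; - 2; 4]).
- by move=> a; rewrite !inE => /or3P[]/eqP->; algebraic.
- apply/eqP => /polyP/(_ 2%N); rewrite coef_Poly coef0 /= => /eqP.
  by rewrite pnatr_eq0.
- by rewrite horner_Poly /=; have := c_quadratic R; lra.
Qed.

Lemma algebraic_s : alg s.
Proof.
have algc := algebraic_c; apply: algebraic_sqr.
by rewrite /GoldenGnomon.s sin2cos2 -/c; algebraic.
Qed.

Lemma algebraic_p : alg p.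
Proof.
have algc := algebraic_c; have algs := algebraic_s.
have [_ Qp] := p_zeroQ R.
(* These are the coefficients of [Q] by increasing degree, from (t^2 - 1)(t^2 - 4t + 1) = t^4 - 4t^3
   + 4t - 1. *)
apply: (@algebraic_root_Poly _ [:: 7 + 30 * c + 4 * s * c;
  94 + 300 * c - 16 * s * c; 134 + 428 * c; 94 + 300 * c + 16 * s * c;
  7 + 30 * c - 4 * s * c]).
- move=> a; rewrite !inE.
  by do 4?[case/orP => [/eqP->|]; first by algebraic]; move=> /eqP->; algebraic.
- apply/eqP => /polyP/(_ 2%N); rewrite coef_Poly coef0 /= => /eqP.
  by have := c_gt0 R => c0; rewrite gt_eqF //; lra.
- by rewrite horner_Poly /= -[RHS]Qp /Q; ring.
Qed.

(** From p <= -1/9, D p >= 18 and N p >= -1 follows p D p <= -2 < N p. *)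
Lemma p_lt_q : p < q.
Proof.
have [/andP[pl pu] _] := p_zeroQ R.
have /andP[cl cu] := c_bounds R; have /andP[sl su] := s_bounds R.
have /andP[el eu] := sc_bounds R; have D0 := D_gt0 R.
have h1 : 0 <= p ^+ 2 by exact: sqr_ge0.
have h2 : - (1 / 8) * c <= c * p by nra.
have h3 : 0 <= c * p ^+ 2 by apply: mulr_ge0 => //; lra.
have h4 : 0 <= s * p ^+ 2 by apply: mulr_ge0 => //; lra.
have h5 : 0 <= s * c * p ^+ 2 by apply: mulr_ge0 => //; lra.
have h6 : - (1 / 8) * s <= s * p by nra.
have h7 : - (1 / 8) * (s * c) <= s * c * p by nra.
have h8 : p ^+ 2 <= c * p ^+ 2 * 4 by nra.
have DE : D p = 12 * (s * c * p ^+ 2) + 12 * (c * p ^+ 2) + 24 * (c * p)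
  + 20 * (s * c) + 12 * c + 6 * (s * p ^+ 2) + 3 * p ^+ 2 + 10 * p + 2 * s + 3.
  by rewrite /D; ring.
have NE : N p = 4 * (s * c * p ^+ 2) + 4 * (c * p ^+ 2) + 24 * (s * c * p)
  + 4 * (s * c) - 4 * c + 2 * (s * p ^+ 2) - p ^+ 2 + 4 * (s * p) + 2 * s + 1.
  by rewrite /N; ring.
have D18 : 18 <= D p by rewrite DE; lra.
have N1 : - 1 <= N p by rewrite NE; lra.
rewrite /GoldenGnomon.q ltr_pdivlMr //.
have : p * D p <= - (1 / 9) * D p by rewrite ler_pM2r.
lra.
Qed.

End EscapeConstant.

Theorem corollaryB1 (R : realType) : transcendental (GoldenGnomon.C R).
Proof.
have algc := algebraic_c R; have algs := algebraic_s R.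
have algp := algebraic_p R.
have c0 := GoldenGnomon.c_gt0 R; have s0 := GoldenGnomon.s_gt0 R.
have algq : algebraicOver ratr (GoldenGnomon.q R).
  rewrite /GoldenGnomon.q /GoldenGnomon.N /GoldenGnomon.D.
  by algebraic.
have double_angle (x : R) : algebraicOver ratr x -> algebraic_angle (2 * atan x).
  move=> algx; rewrite mulr_natl mulr2n.
  by apply: algebraic_angleD; exact: algebraic_angle_atan.
have anga : algebraic_angle (GoldenGnomon.a R) := double_angle _ algp.
have angb : algebraic_angle (GoldenGnomon.b R) := double_angle _ algq.
(* Up to unfolding, this is the pair [algc], [algs]. *)
have angbeta : algebraic_angle (GoldenGnomon.beta R) by [].
have alglam : algebraicOver ratr (GoldenGnomon.lambda R).
  have [_ ?] := anga.
  have [_ ?] := algebraic_angleD anga angbeta.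
  have [_ ?] := algebraic_angleD angb angbeta.
  rewrite /GoldenGnomon.lambda.
  by algebraic.
move=> algC.
apply: (@lindemann_angle R (GoldenGnomon.b R - GoldenGnomon.a R)).
- rewrite /GoldenGnomon.a /GoldenGnomon.b -mulrBr mulr_gt0 // subr_gt0.
  exact/lt_atan/p_lt_q.
(* The definition of [C] is solved for b - a. *)
- have -> : GoldenGnomon.b R - GoldenGnomon.a R =
      GoldenGnomon.c R * (GoldenGnomon.C R /
      (2 * GoldenGnomon.s R * GoldenGnomon.c R) - GoldenGnomon.lambda R).
    by rewrite /GoldenGnomon.C; field; rewrite !gt_eqF.
  by algebraic.
- exact/algebraic_angleD/algebraic_angleN.
Qed.
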